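(* Let $p\in[1,\infty)$ and $n\in\mathbb{N}$. Let $m:[0,\infty)\to[0,\infty)$ be a log-concave function such that $0<\int_{\mathbb{R}^n}m(\|x\|_p^p)\,dx<\infty$, and let $\mu$ be the probability measure on $\mathbb{R}^n$ whose density at $x$ is proportional to $m(\|x\|_p^p)$. Let $\{i_1,\dots,i_k\}$ and $\{j_1,\dots,j_l\}$ be two disjoint subsets of $\{1,\dots,n\}$, and let $f:[0,\infty)^k\to\mathbb{R}$ and $g:[0,\infty)^l\to\mathbb{R}$ be (measurable) radius-wise increasing functions such that $x\mapsto f(|x_{i_1}|,\dots,|x_{i_k}|)$ and $x\mapsto g(|x_{j_1}|,\dots,|x_{j_l}|)$ are bounded on $\mathrm{supp}\,\mu$. Let $X=(X_1,\dots,X_n)$ be a random vector distributed according to $\mu$. Then $$\mathrm{Cov}\big(f(|X_{i_1}|,\dots,|X_{i_k}|),\,g(|X_{j_1}|,\dots,|X_{j_l}|)\big)\le 0.$$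
   Context: $\|x\|_p=(\sum_i|x_i|^p)^{1/p}$. A function $m\ge 0$ is log-concave if $\ln m$ is concave (with $\ln 0=-\infty$). A function $f:[0,\infty)^k\to\mathbb{R}$ is radius-wise increasing if $f(tx_1,\dots,tx_k)\ge f(x_1,\dots,x_k)$ for all $x\in[0,\infty)^k$ and all $t>1$. *)

(* Defs.v *)
From HB Require Import structures.
From mathcomp Require Import all_boot all_order all_algebra.
From mathcomp Require Import all_classical all_reals all_analysis.

Set Implicit Arguments.
Unset Strict Implicit.
Unset Printing Implicit Defensive.

Import Order.TTheory GRing.Theory Num.Theory.
Import numFieldNormedType.Exports.

Local Open Scope classical_set_scope.
Local Open Scope ring_scope.

(* R^n is [n.-tuple R]; the sigma-algebra that the library puts on it, generated
   by the coordinate maps, is the Borel sigma-algebra. *)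

Section LebesgueMeasure.
Context {R : realType}.

Lemma product_measure1_sigma_finite d1 d2
    (T1 : measurableType d1) (T2 : measurableType d2)
    (m1 : {sigma_finite_measure set T1 -> \bar R})
    (m2 : {sigma_finite_measure set T2 -> \bar R}) :
  sigma_finite setT (m1 \x m2)%E.
Proof.
have /sigma_finiteP[F [TF ndF Foo]] := sigma_finiteT m1.
have /sigma_finiteP[G [TG ndG Goo]] := sigma_finiteT m2.
exists (fun n => F n `*` G n).
  rewrite -setXTT TF TG predeqE => -[x y]; split.
    move=> [/= [n _ Fnx] [k _ Gky]]; exists (maxn n k) => //; split.
    - by move: x Fnx; exact/subsetPset/ndF/leq_maxl.
    - by move: y Gky; exact/subsetPset/ndG/leq_maxr.
  by move=> [n _ []/= ? ?]; split; exists n.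
move=> k; have [? ?] := Foo k; have [? ?] := Goo k.
split; first exact: measurableX.
by rewrite product_measure1E// lte_mul_pinfty// ge0_fin_numE.
Qed.

(* [measurableTypeR R], the domain of [lebesgue_measure], is R with the same
   Borel sets but another display. *)
Definition join_tuple n (x : measurableTypeR R * n.-tuple R) : n.+1.-tuple R :=
  [tuple of x.1 :: x.2].

Definition split_tuple n (x : n.+1.-tuple R) : measurableTypeR R * n.-tuple R :=
  (thead x, [tuple of behead x]).

Lemma join_tupleK n : cancel (@join_tuple n) (@split_tuple n).
Proof.
case=> a x; rewrite /split_tuple /join_tuple theadE; congr pair.
exact: val_inj.
Qed.

Lemma measurable_join_tuple n :
  measurable_fun [set: measurableTypeR R * n.-tuple R] (@join_tuple n).
Proof. exact: (measurable_cons measurable_fst measurable_snd). Qed.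

Lemma measurable_split_tuple n :
  measurable_fun [set: n.+1.-tuple R] (@split_tuple n).
Proof.
apply: measurable_fun_pair; first exact: (@measurable_tnth _ R n.+1 ord0).
apply/measurable_fun_tnthP => i.
rewrite (_ : _ \o _ = @tnth _ R ^~ (lift ord0 i)); first exact: measurable_tnth.
by apply/funext => x /=; rewrite [in RHS](tuple_eta x) tnthS.
Qed.

HB.instance Definition _ n :=
  isMeasurableFun.Build _ _ _ _ (@join_tuple n) (@measurable_join_tuple n).

Section step.
Variables (n : nat) (nu : {sigma_finite_measure set (n.-tuple R) -> \bar R}).

Definition lebesgue_step : set (n.+1.-tuple R) -> \bar R :=
  pushforward (lebesgue_measure \x nu)%E (@join_tuple n).

Let lebesgue_step0 : lebesgue_step set0 = 0%E.
Proof. exact: measure0. Qed.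

Let lebesgue_step_ge0 A : (0 <= lebesgue_step A)%E.
Proof. exact: measure_ge0. Qed.

Let lebesgue_step_sigma_additive : semi_sigma_additive lebesgue_step.
Proof. exact: measure_semi_sigma_additive. Qed.

HB.instance Definition _ := isMeasure.Build _ _ _ lebesgue_step
  lebesgue_step0 lebesgue_step_ge0 lebesgue_step_sigma_additive.

Let lebesgue_step_sigma_finite : sigma_finite setT lebesgue_step.
Proof.
have [F FT mF] := product_measure1_sigma_finite lebesgue_measure nu.
exists (fun i => @split_tuple n @^-1` F i).
  by rewrite -preimage_bigcup -FT preimage_setT.
move=> i; have [mFi Fioo] := mF i; split.
  by rewrite -[X in measurable X]setTI; exact: measurable_split_tuple.
rewrite /lebesgue_step /pushforward -comp_preimage.
by rewrite (_ : _ \o _ = id)//; apply/funext => x /=; rewrite join_tupleK.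
Qed.

HB.instance Definition _ := Measure_isSigmaFinite.Build _ _ _
  lebesgue_step lebesgue_step_sigma_finite.

End step.

Fixpoint lebesgue_measureRn n :
    {sigma_finite_measure set (n.-tuple R) -> \bar R} :=
  match n with
  | 0 => dirac ([tuple] : 0.-tuple R)
  | n'.+1 => lebesgue_step (lebesgue_measureRn n')
  end.

End LebesgueMeasure.

(* This characterises Lebesgue measure on R^n. *)
Lemma lebesgue_measureRn_box {R : realType} n (A : 'I_n -> set R) :
  (forall i, measurable (A i)) ->
  lebesgue_measureRn n [set x | forall i, A i (tnth x i)] =
  (\prod_(i < n) lebesgue_measure (A i))%E.
Proof.
elim: n A => [|n IHn] A mA.
  by rewrite big_ord0 /= diracE mem_set//= => -[].
have mB : measurable [set y : n.-tuple R | forall i, A (lift ord0 i) (tnth y i)].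
  rewrite (_ : [set _ | _] = \bigcap_(i in [set: 'I_n])
      (fun y : n.-tuple R => tnth y i) @^-1` A (lift ord0 i)).
    apply: fin_bigcap_measurable => // i _.
    by rewrite -[X in measurable X]setTI; exact: measurable_tnth.
  apply/seteqP; split=> y /= Ay i; last exact: Ay.
  by move=> _; exact: Ay.
rewrite big_ord_recl -IHn; last by move=> i; exact: mA.
rewrite -product_measure1E//=; last exact: mA.
rewrite /lebesgue_step /pushforward; congr (product_measure1 _ _ _).
apply/seteqP; split=> -[a y] /=.
  move=> Ay; split=> [|i]; first exact: (Ay ord0).
  by have := Ay (lift ord0 i); rewrite tnthS.
move=> [Aa Ay] i; have [j ->|->] := unliftP ord0 i; last exact: Aa.
by rewrite tnthS; exact: Ay.
Qed.

Section LpLogConcave.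
Context {R : realType}.

Definition lpnorm n (p : R) (x : n.-tuple R) : R :=
  (\sum_(i < n) `|tnth x i| `^ p) `^ p^-1.

(* [lne] is the extended logarithm: [lne 0 = -oo]. *)
Definition log_concave (m : R -> R) : Prop :=
  forall x y t : R, 0 <= x -> 0 <= y -> 0 <= t <= 1 ->
    (t%:E * lne (m x)%:E + (1 - t)%:E * lne (m y)%:E
       <= lne (m (t * x + (1 - t) * y))%:E)%E.

Definition orthant k : set (k.-tuple R) :=
  [set x | forall i, 0 <= tnth x i].

Definition radiuswise_increasing k (f : k.-tuple R -> R) : Prop :=
  forall (x : k.-tuple R) (t : R), orthant x -> 1 < t ->
    f x <= f [tuple t * tnth x i | i < k].

Definition row_of_tuple n (x : n.-tuple R) : 'rV[R]_n := \row_i tnth x i.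

(* The topology of R^n is the library's topology on row vectors. *)
Definition supp n (mu : set (n.-tuple R) -> \bar R) : set (n.-tuple R) :=
  [set x | forall U : set 'rV[R]_n, open U -> U (row_of_tuple x) ->
     (0 < mu (@row_of_tuple n @^-1` U))%E].

Definition density_proportional n (mu : set (n.-tuple R) -> \bar R)
    (h : n.-tuple R -> R) : Prop :=
  exists c : R, forall A, measurable A ->
    mu A = (\int[lebesgue_measureRn n]_(x in A) (c * h x)%:E)%E.

Definition abs_coords n k (i : 'I_k -> 'I_n) (x : n.-tuple R) : k.-tuple R :=
  [tuple `|tnth x (i a)| | a < k].

End LpLogConcave.

(* Main.v *)
Require Import Defs.
From HB Require Import structures.
From mathcomp Require Import all_boot all_order all_algebra.
From mathcomp Require Import all_classical all_reals all_analysis.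
From mathcomp Require Import measurable_realfun.
From mathcomp Require Import ring lra.
Import Order.TTheory GRing.Theory Num.Theory.
Import numFieldNormedType.Exports.
Local Open Scope classical_set_scope.
Local Open Scope ring_scope.

(** Let [I] be the block of coordinates seen by [f].  Any function of a subset of the
complementary coordinates that is radius-wise increasing is also radius-wise
increasing in all of them, so [f] and [g] may be taken to live on two blocks
that together exhaust the coordinates; the density is then [m (r + s)] where [r] and [s]
are the p-th powers of the l_p norms of the blocks.  Passing to polar coordinates in each block
and averaging over the directions replaces [f] and [g] by monotone functions of the two
radii.  Log-concavity of [m] makes [m (r + s)] reverse-rule of order two:
[m (r + s) * m (r' + s') <= m (r + s') * m (r' + s)] for [r <= r'] and [s <= s'], and
symmetrizing [E(FG) - E(F) E(G)] over exchanges of the radii gives an integrand of constant sign.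

Polar coordinates are obtained from Tonelli's theorem and the scaling of Lebesgue
measure only: one inserts [1 = \int_(t > 0) N x * 1_(t * N x <= 1) dt] for the norm [N], substitutes
[x := x / t], then [t := N x * tau]; the sphere is thereby replaced by the unit ball. *)

(** * Lebesgue measure on R^n under scaling *)

(** Inversion is discontinuous at 0, so it is written on each side of 0 through the measurable power
    with exponent -1. The conventional value 0 at 0 agrees with that of the power. *)
Lemma measurable_invr (R : realType) : measurable_fun [set: R] (@GRing.inv R).
Proof.
have -> : @GRing.inv R = fun x => if 0 < x then x `^ (-1) else - ((- x) `^ (-1)).
  apply/funext => x; case: ltP => [x0|x0]; first by rewrite powR_inv1 // ltW.
  by rewrite powR_inv1 ?oppr_ge0// invrN opprK.
apply: measurable_fun_ifT.
- exact: measurable_fun_ltr.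
- exact: measurable_powR.
- apply: measurable_funN.
  exact: (@measurableT_comp _ _ _ _ _ _ (@powR R ^~ (-1))).
Qed.

(** Multiplying the image of Lebesgue measure under [x |-> c * x] by [c] gives every half-open
    interval its length, so uniqueness of Lebesgue measure applies. *)
Lemma lebesgue_measure_scale (R : realType) (c : R) (A : set R) : 0 < c -> measurable A ->
  lebesgue_measure [set x | A (c * x)] = (c^-1%:E * lebesgue_measure A)%E.
Proof.
move=> c0 mA.
have mc : measurable_fun setT (fun x : measurableTypeR R => c * x : measurableTypeR R).
  by apply: measurable_funM.
pose phi (x : measurableTypeR R) : measurableTypeR R := c * x.
pose nu := mscale (NngNum (ltW c0))
  (measure_function_pushforward__canonical__measure_function_Measure
    lebesgue_measure (mc : measurable_fun setT phi)).
have nuE B : nu B = (c%:E * lebesgue_measure [set x : R | B (c * x)%R])%E by [].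
suff -> : lebesgue_measure A = nu A.
  by rewrite nuE muleA -EFinM mulVf ?gt_eqF// mul1e.
apply: lebesgue_measure_unique => // X [[a b] _ <-]; rewrite -[RHS]/(nu `]a, b]%classic) nuE.
rewrite [X in (_ * lebesgue_measure X)%E](_ : _ = `]a / c, b / c]%classic); last first.
  by apply/seteqP; split=> x /=; rewrite !in_itv/= ltr_pdivrMr// ler_pdivlMr// mulrC.
rewrite !lebesgue_measure_itv/= !lte_fin ltr_pM2r ?invr_gt0//.
case: ifP => _; last by rewrite mule0.
by rewrite -EFinD -EFinM mulrBr !(mulrC c) !divfK ?gt_eqF.
Qed.

Lemma ge0_integral_lebesgue_scale (R : realType) (c : R) (h : R -> \bar R) : 0 < c ->
  measurable_fun setT h -> (forall x, 0 <= h x)%E ->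
  (\int[lebesgue_measure]_x h (c * x)%R = c^-1%:E * \int[lebesgue_measure]_x h x)%E.
Proof.
move=> c0 mh h0.
have mc : measurable_fun setT (fun x : measurableTypeR R => c * x : measurableTypeR R).
  by apply: measurable_funM.
have ci0 : 0 <= c^-1 by rewrite invr_ge0 ltW.
have := @ge0_integral_pushforward _ _ _ _ _ _ mc lebesgue_measure _ h
  measurableT mh (fun y _ => h0 y).
rewrite preimage_setT => <-.
rewrite -(@ge0_integral_mscale _ _ _ lebesgue_measure _ measurableT (NngNum ci0))//.
by apply: eq_measure_integral => A mA _; exact: lebesgue_measure_scale.
Qed.

Definition box {R : realType} n (A : 'I_n -> set R) : set (n.-tuple R) :=
  [set x | forall i, A i (tnth x i)].

Lemma measurable_box (R : realType) n (A : 'I_n -> set R) :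
  (forall i, measurable (A i)) -> measurable (box n A).
Proof.
move=> mA.
rewrite (_ : box _ _ = \bigcap_(i in [set: 'I_n])
    (fun y : n.-tuple R => tnth y i) @^-1` A i).
  apply: fin_bigcap_measurable => // i _.
  by rewrite -[X in measurable X]setTI; exact: measurable_tnth.
by apply/seteqP; split=> y /= Ay i; [move=> _|]; exact: Ay.
Qed.

Lemma measurable_tuple_box (R : realType) n :
  @measurable _ (n.-tuple R) =
  <<s [set box n A | A in [set A : 'I_n -> set R | forall i, measurable (A i)]] >>.
Proof.
apply/seteqP; split.
  apply: smallest_sub; first exact: smallest_sigma_algebra.
  rewrite -bigcup_seq => _ [i _ [A mA <-]]; apply: sub_sigma_algebra.
  exists (fun j => if j == i then A else setT).
    by move=> j /=; case: ifP.
  apply/seteqP; split=> x /=; first by move=> /(_ i); rewrite eqxx.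
  by move=> [_ Ax] j; case: eqP => // ->.
apply: smallest_sub; first exact: sigma_algebra_measurable.
by move=> _ [A mA <-]; exact: measurable_box.
Qed.

(** Measurable boxes are stable under intersection and generate the sigma-algebra, and the cubes
    with sides [[-k, k]] have finite measure and exhaust the space. Later changes of variables thus
    need checking on boxes only. *)
Lemma lebesgue_measureRn_unique (R : realType) n
    (nu : {measure set (n.-tuple R) -> \bar R}) :
  (forall A, (forall i, measurable (A i)) ->
    nu (box n A) = \prod_(i < n) lebesgue_measure (A i))%E ->
  forall B, measurable B -> nu B = lebesgue_measureRn n B.
Proof.
move=> nuE; pose g (k : nat) := box n (fun=> `[- k%:R, k%:R]%classic : set R).
apply: (@measure_unique _ _ _
  [set box n A | A in [set A : 'I_n -> set R | forall i, measurable (A i)]] g).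
- exact: measurable_tuple_box.
- move=> _ _ [A mA <-] [B mB <-]; exists (fun i => A i `&` B i).
    by move=> i; exact: measurableI.
  apply/seteqP; split=> x /=; first by move=> AB; split=> i; case: (AB i).
  by move=> [Ax Bx] i; split; [exact: Ax|exact: Bx].
- by move=> k; exists (fun=> `[- k%:R, k%:R]%classic).
(* An integer above the sum of the absolute coordinates bounds each of them. *)
- apply/seteqP; split=> // x _; exists (Num.truncn (\sum_i `|tnth x i|)).+1 => // i.
  rewrite /= in_itv/= -ler_norml (le_trans _ (ltW (truncnS_gt _)))//.
  by rewrite (bigD1 i)//= lerDl sumr_ge0.
- by move=> _ [A mA <-]; rewrite nuE//; exact/esym/lebesgue_measureRn_box.
- move=> k; rewrite nuE//; rewrite ltey_eq; apply/orP; left.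
  apply: (big_ind (fun x : \bar R => x \is a fin_num)) => //.
    by move=> x y; exact: fin_numM.
  move=> i _; rewrite lebesgue_measure_itv/=; case: ifP => // _.
  Qed.

Definition scale_tuple {R : realType} n (t : R) (x : n.-tuple R) : n.-tuple R :=
  [tuple t * tnth x i | i < n].

Lemma measurable_scale_tuple (R : realType) n :
  measurable_fun setT (fun z : R * n.-tuple R => scale_tuple n z.1 z.2).
Proof.
apply/measurable_fun_tnthP => i.
rewrite (_ : _ \o _ = (fun z => z.1 * tnth z.2 i)); last first.
  by apply/funext => z /=; rewrite tnth_mktuple.
apply: measurable_funM => //.
by apply: (@measurableT_comp _ _ _ _ _ _ (fun x : n.-tuple R => tnth x i)) => //;
  exact: measurable_tnth.
Qed.

(** On a box each of the [n] sides contributes a factor [c^-1]. Hence [c ^+ n] times the image of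
    Lebesgue measure under the dilation is Lebesgue measure. *)
Lemma ge0_integral_lebesgueRn_scale (R : realType) n (c : R) (h : n.-tuple R -> \bar R) :
  0 < c -> measurable_fun setT h -> (forall x, 0 <= h x)%E ->
  (\int[lebesgue_measureRn n]_x h (scale_tuple n c x) =
   (c^-1 ^+ n)%:E * \int[lebesgue_measureRn n]_x h x)%E.
Proof.
move=> c0 mh h0.
have mc : measurable_fun setT (scale_tuple n c).
  apply: (@measurableT_comp _ _ _ _ _ _ (fun z => scale_tuple n z.1 z.2) _
    (fun x => (c, x))); first exact: measurable_scale_tuple.
  exact: measurable_fun_pair.
have cn0 : 0 <= c ^+ n by rewrite exprn_ge0// ltW.
pose nu := mscale (NngNum cn0)
  (measure_function_pushforward__canonical__measure_function_Measure
    (lebesgue_measureRn n) mc).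
have nuE B : nu B = ((c ^+ n)%:E * lebesgue_measureRn n (scale_tuple n c @^-1` B))%E by [].
have nu_lebesgue B : measurable B -> nu B = lebesgue_measureRn n B.
  apply: lebesgue_measureRn_unique => A mA; rewrite -[LHS]/(nu _) nuE.
  rewrite (_ : _ @^-1` _ = box n (fun i => [set x : R | A i (c * x)])); last first.
    by apply/seteqP; split=> x /= Ax i; have := Ax i; rewrite tnth_mktuple.
  rewrite (@lebesgue_measureRn_box _ n (fun i => [set x : R | A i (c * x)])); last first.
    move=> i; rewrite -[X in measurable X]setTI.
    by apply: (_ : measurable_fun setT ( *%R c)) => //; exact: measurable_funM.
  rewrite (eq_bigr (fun i => c^-1%:E * lebesgue_measure (A i))%E); last first.
    by move=> i _; rewrite lebesgue_measure_scale.
  rewrite big_split/= muleA prodEFin -EFinM prodr_const card_ord exprVn.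
  by rewrite mulfV ?mul1e// expf_neq0// gt_eqF.
have := @ge0_integral_pushforward _ _ _ _ _ _ mc (lebesgue_measureRn n) _ h
  measurableT mh (fun y _ => h0 y).
rewrite preimage_setT => <-.
rewrite -(eq_measure_integral (lebesgue_measureRn n) (m1 := nu)); last first.
  by move=> A mA _; exact: nu_lebesgue.
rewrite ge0_integral_mscale//= muleA -EFinM exprVn mulVf ?mul1e//.
by rewrite expf_neq0// gt_eqF.
Qed.

(** * The reverse rule and negative correlation *)

(** By Tonelli, exchanging the two variables preserves a double integral, so each side is half the
    integral of its symmetrization. The last cancellation is by the finite factor 2, so infinite
    integrals are covered. *)
Lemma le_integral_symmetrized d (T : measurableType d) (R : realType)
    (mu : {sigma_finite_measure set T -> \bar R}) (f g : T * T -> \bar R) :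
  measurable_fun setT f -> measurable_fun setT g ->
  (forall z, 0 <= f z)%E -> (forall z, 0 <= g z)%E ->
  (forall x y, f (x, y) + f (y, x) <= g (x, y) + g (y, x))%E ->
  (\int[mu]_x \int[mu]_y f (x, y) <= \int[mu]_x \int[mu]_y g (x, y))%E.
Proof.
move=> mf mg f0 g0 fg.
have sym h : measurable_fun setT h -> (forall z, 0 <= h z)%E ->
    (\int[mu]_x \int[mu]_y (h (x, y) + h (y, x)) =
     2%:E * \int[mu]_x \int[mu]_y h (x, y))%E.
  move=> mh h0.
  have mh' : measurable_fun setT (fun z => h (z.2, z.1)).
    by apply: (measurableT_comp mh); exact: measurable_fun_pair.
  under eq_integral => x _.
    rewrite ge0_integralD//; last 2 first.
    - exact: measurableT_comp.
    - by apply: (measurableT_comp mh).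
    over.
  rewrite ge0_integralD//; last 4 first.
  - by move=> x _; exact: integral_ge0.
  - exact: measurable_fun_fubini_tonelli_F.
  - by move=> x _; exact: integral_ge0.
  - exact: (@measurable_fun_fubini_tonelli_F _ _ _ _ _ _ (fun z => h (z.2, z.1))).
  have <- := @fubini_tonelli _ _ _ _ _ mu mu h mh h0.
  by rewrite -mule2n -mule_natl.
have : (2%:E * \int[mu]_x \int[mu]_y f (x, y) <=
        2%:E * \int[mu]_x \int[mu]_y g (x, y))%E.
  rewrite -!sym//; apply: ge0_le_integral => //.
  - by move=> x _; apply: integral_ge0 => y _; rewrite adde_ge0.
  - apply: (@measurable_fun_fubini_tonelli_F _ _ _ _ _ _
      (fun z => f (z.1, z.2) + f (z.2, z.1))%E) => [|z]; last by rewrite adde_ge0.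
    by apply: emeasurable_funD; apply: measurableT_comp => //;
      exact: measurable_fun_pair.
  - apply: (@measurable_fun_fubini_tonelli_F _ _ _ _ _ _
      (fun z => g (z.1, z.2) + g (z.2, z.1))%E) => [|z]; last by rewrite adde_ge0.
    by apply: emeasurable_funD; apply: measurableT_comp => //;
      exact: measurable_fun_pair.
  - move=> x _; apply: ge0_le_integral => //.
    + by move=> y _; rewrite adde_ge0.
    + by apply: emeasurable_funD; apply: measurableT_comp => //;
        exact: measurable_fun_pair.
    + by apply: emeasurable_funD; apply: measurableT_comp => //;
        exact: measurable_fun_pair.
by rewrite lee_pmul2l.
Qed.

(** Turns products of single integrals into one double integral over two independent copies of the
    variable, where symmetrization can act. *)
Lemma integral2_separated d (T : measurableType d) (R : realType)
    (mu : {sigma_finite_measure set T -> \bar R}) (p q p' q' : T -> R) :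
  measurable_fun setT p -> measurable_fun setT q ->
  measurable_fun setT p' -> measurable_fun setT q' ->
  (forall x, 0 <= p x) -> (forall x, 0 <= q x) ->
  (forall x, 0 <= p' x) -> (forall x, 0 <= q' x) ->
  (\int[mu]_x \int[mu]_y (p x * q y + p' x * q' y)%:E =
   (\int[mu]_x (p x)%:E) * (\int[mu]_x (q x)%:E) +
   (\int[mu]_x (p' x)%:E) * (\int[mu]_x (q' x)%:E))%E.
Proof.
move=> mp mq mp' mq' p0 q0 p'0 q'0.
have int0 (h : T -> R) : (forall x, 0 <= h x) -> (0 <= \int[mu]_x (h x)%:E)%E.
  by move=> h0; apply: integral_ge0 => x _; rewrite lee_fin.
have E1 x : (\int[mu]_y (p x * q y + p' x * q' y)%:E =
    (p x)%:E * (\int[mu]_y (q y)%:E) + (p' x)%:E * (\int[mu]_y (q' y)%:E))%E.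
  under eq_integral do rewrite EFinD !EFinM.
  rewrite ge0_integralD//; last 4 first.
  - by move=> y _; rewrite -EFinM lee_fin mulr_ge0.
  - by apply: emeasurable_funM => //; exact/measurable_EFinP.
  - by move=> y _; rewrite -EFinM lee_fin mulr_ge0.
  - by apply: emeasurable_funM => //; exact/measurable_EFinP.
  rewrite !ge0_integralZl ?lee_fin//; try exact/measurable_EFinP.
  - by move=> y _; rewrite lee_fin.
  - by move=> y _; rewrite lee_fin.
under eq_integral do rewrite E1.
rewrite ge0_integralD//; last 4 first.
- by move=> x _; rewrite mule_ge0 ?lee_fin ?int0.
- by apply: emeasurable_funM => //; exact/measurable_EFinP.
- by move=> x _; rewrite mule_ge0 ?lee_fin ?int0.
- by apply: emeasurable_funM => //; exact/measurable_EFinP.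
rewrite !ge0_integralZr ?int0//; try exact/measurable_EFinP.
- by move=> x _; rewrite lee_fin.
- by move=> x _; rewrite lee_fin.
Qed.

(** Up to normalization this is a covariance inequality for the weight [W]. Writing each product of
    integrals over two copies [(x, y)] and [(x', y')] and symmetrizing in [x, x'], then in [y, y'],
    leaves exactly the expression whose sign is assumed. *)
Lemma integral_reverse_rule d1 d2 (X : measurableType d1) (Y : measurableType d2)
    (R : realType) (mu : {sigma_finite_measure set X -> \bar R})
    (nu : {sigma_finite_measure set Y -> \bar R})
    (F : X -> R) (G : Y -> R) (W : X * Y -> R) :
  measurable_fun setT F -> measurable_fun setT G -> measurable_fun setT W ->
  (forall x, 0 <= F x) -> (forall y, 0 <= G y) -> (forall z, 0 <= W z) ->
  (forall x x' y y', (F x - F x') * (G y - G y') *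
     (W (x, y) * W (x', y') - W (x, y') * W (x', y)) <= 0) ->
  ((\int[mu]_x \int[nu]_y (F x * G y * W (x, y))%:E) *
   (\int[mu]_x \int[nu]_y (W (x, y))%:E) <=
   (\int[mu]_x \int[nu]_y (F x * W (x, y))%:E) *
   (\int[mu]_x \int[nu]_y (G y * W (x, y))%:E))%E.
Proof.
move=> mF mG mW F0 G0 W0 H.
have mWx x : measurable_fun setT (fun y => W (x, y)).
  by apply: measurableT_comp => //; exact: measurable_fun_pair.
have mGW : measurable_fun setT (fun z => G z.2 * W z).
  by apply: measurable_funM => //; exact: measurableT_comp.
pose w u := (\int[nu]_y (W (u, y))%:E)%E.
pose v u := (\int[nu]_y (G y * W (u, y))%:E)%E.
have w0 x : (0 <= w x)%E by apply: integral_ge0 => y _; rewrite lee_fin.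
have v0 x : (0 <= v x)%E.
  by apply: integral_ge0 => y _; rewrite lee_fin mulr_ge0.
have mw : measurable_fun setT w.
  apply: (@measurable_fun_fubini_tonelli_F _ _ _ _ _ _ (EFin \o W)) => [|z].
    exact/measurable_EFinP.
  by rewrite lee_fin.
have mv : measurable_fun setT v.
  apply: (@measurable_fun_fubini_tonelli_F _ _ _ _ _ _
    (EFin \o (fun z => G z.2 * W z))) => [|z]; first exact/measurable_EFinP.
  by rewrite lee_fin mulr_ge0.
have F0' : forall x, (0 <= (F x)%:E)%E by move=> x; rewrite lee_fin.
have FwE x : (\int[nu]_y (F x * W (x, y))%:E = (F x)%:E * w x)%E.
  under eq_integral do rewrite EFinM.
  rewrite ge0_integralZl//; first exact/measurable_EFinP.
  by move=> y _; rewrite lee_fin.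
have FvE : forall u, (\int[nu]_y (F u * G y * W (u, y))%:E = (F u)%:E * v u)%E.
  move=> u; under eq_integral do rewrite -mulrA EFinM.
  rewrite ge0_integralZl//.
  - by apply/measurable_EFinP; exact: measurable_funM.
  - by move=> y _; rewrite lee_fin mulr_ge0.
pose a u := ((F u)%:E * v u)%E; pose b u := ((F u)%:E * w u)%E.
have mF' : measurable_fun setT (EFin \o F) by exact/measurable_EFinP.
have a0 : forall u, (0 <= a u)%E by move=> t; rewrite mule_ge0.
have b0 : forall u, (0 <= b u)%E by move=> t; rewrite mule_ge0.
have ma : measurable_fun setT a by exact: emeasurable_funM.
have mb : measurable_fun setT b by exact: emeasurable_funM.
have prodE (h k : X -> \bar R) : measurable_fun setT h -> measurable_fun setT k ->
    (forall t, 0 <= h t)%E -> (forall t, 0 <= k t)%E ->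
    ((\int[mu]_x h x) * (\int[mu]_x k x) =
     \int[mu]_x \int[mu]_x' (h x * k x'))%E.
  move=> mh mk h0 k0; under [RHS]eq_integral do rewrite ge0_integralZl//.
  by rewrite ge0_integralZr//; exact: integral_ge0.
rewrite [X in (X * _ <= _)%E](_ : _ = \int[mu]_x a x)%E; last exact: eq_integral.
rewrite [X in (_ <= X * _)%E](_ : _ = \int[mu]_x b x)%E; last exact: eq_integral.
rewrite [X in (_ * X <= _)%E](_ : _ = \int[mu]_x w x)%E//.
rewrite [X in (_ <= _ * X)%E](_ : _ = \int[mu]_x v x)%E//.
(* First symmetrization, over the exchange of [x] and [x']. *)
rewrite (prodE _ _ ma mw a0 w0) (prodE _ _ mb mv b0 v0).
apply: (@le_integral_symmetrized _ _ _ _ (fun z => a z.1 * w z.2)%E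
  (fun z => b z.1 * v z.2)%E) => [||z|z|x x' /=].
- by apply: emeasurable_funM; exact: measurableT_comp.
- by apply: emeasurable_funM; exact: measurableT_comp.
- by rewrite mule_ge0.
- by rewrite mule_ge0.
(* With [x] and [x'] fixed, [f] and [g] spread the remaining products over two copies of the second
   variable. They are arranged so that symmetrizing in [y, y'] makes their difference factor. *)
pose f z := (F x * G z.1 * W (x, z.1) * W (x', z.2) +
  W (x, z.1) * (F x' * G z.2 * W (x', z.2)))%:E.
pose g z := (F x * W (x, z.1) * (G z.2 * W (x', z.2)) +
  G z.1 * W (x, z.1) * (F x' * W (x', z.2)))%:E.
have E1 : (a x * w x' + a x' * w x = \int[nu]_y \int[nu]_y' f (y, y'))%E.
  rewrite (integral2_separated _ _ _ _ (fun y => F x * G y * W (x, y))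
    (fun y => W (x', y)) (fun y => W (x, y))
    (fun y => F x' * G y * W (x', y)))//.
  - by rewrite /a -!FvE (muleC (\int[nu]_y _)%E (w x)).
  - by do 2 apply: measurable_funM => //.
  - by do 2 apply: measurable_funM => //.
  - by move=> y; rewrite !mulr_ge0.
  - by move=> y; rewrite !mulr_ge0.
have E2 : (b x * v x' + b x' * v x = \int[nu]_y \int[nu]_y' g (y, y'))%E.
  rewrite (integral2_separated _ _ _ _ (fun y => F x * W (x, y))
    (fun y => G y * W (x', y)) (fun y => G y * W (x, y))
    (fun y => F x' * W (x', y)))//.
  - by rewrite /b -!FwE (muleC (\int[nu]_y (F x' * _)%:E)%E (v x)).
  - by apply: measurable_funM.
  - by apply: measurable_funM.
  - by apply: measurable_funM.
  - by apply: measurable_funM.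
  - by move=> y; rewrite !mulr_ge0.
  - by move=> y; rewrite !mulr_ge0.
  - by move=> y; rewrite !mulr_ge0.
  - by move=> y; rewrite !mulr_ge0.
have mW1 u : measurable_fun setT (fun z : Y * Y => W (u, z.1)).
  exact: (measurableT_comp (mWx u) measurable_fst).
have mW2 u : measurable_fun setT (fun z : Y * Y => W (u, z.2)).
  exact: (measurableT_comp (mWx u) measurable_snd).
have mG1 : measurable_fun setT (fun z : Y * Y => G z.1).
  exact: (measurableT_comp mG measurable_fst).
have mG2 : measurable_fun setT (fun z : Y * Y => G z.2).
  exact: (measurableT_comp mG measurable_snd).
rewrite E1 E2; apply: le_integral_symmetrized => [||z|z|y y'].
- apply/measurable_EFinP; apply: measurable_funD.
    by do 3 apply: measurable_funM => //.
  by apply: measurable_funM => //; do 2 apply: measurable_funM => //.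
- apply/measurable_EFinP; apply: measurable_funD.
    by apply: measurable_funM; apply: measurable_funM.
  by apply: measurable_funM; apply: measurable_funM.
- by rewrite lee_fin addr_ge0// !mulr_ge0.
- by rewrite lee_fin addr_ge0// !mulr_ge0.
rewrite /f /g /= -!EFinD lee_fin -subr_le0.
rewrite (le_trans _ (H x x' y y'))// le_eqVlt; apply/orP; left; apply/eqP; ring.
Qed.

(** * Polar coordinates *)

Lemma measurable_fun_natr_bool d (T : measurableType d) (R : realType) (b : T -> bool) :
  measurable_fun setT b -> measurable_fun setT (fun x => (b x)%:R : R).
Proof.
move=> mb; rewrite (_ : (fun _ => _) = (fun x => if b x then 1 else 0 : R)).
  exact: measurable_fun_ifT.
by apply/funext => x; case: (b x).
Qed.

Lemma measurable_fun_inv d (T : measurableType d) (R : realType) (f : T -> R) :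
  measurable_fun setT f -> measurable_fun setT (fun x => (f x)^-1).
Proof. by move=> mf; exact: (measurableT_comp (measurable_invr R) mf). Qed.

Lemma measurable_fun_scale_tuple d (T : measurableType d) (R : realType) n
    (u : T -> R) (v : T -> n.-tuple R) :
  measurable_fun setT u -> measurable_fun setT v ->
  measurable_fun setT (fun x => scale_tuple n (u x) (v x)).
Proof.
move=> mu mv.
apply: (@measurableT_comp _ _ _ _ _ _ (fun z => scale_tuple n z.1 z.2) _
  (fun x => (u x, v x))); first exact: measurable_scale_tuple.
exact: measurable_fun_pair.
Qed.

(* The variable [t] of the polar formula is the inverse of the radius. *)
Definition radial_weight {R : realType} (n : nat) (t : R) : R :=
  (0 < t)%R%:R * t^-1 ^+ n.+1.

(** The indicator restricts to the unit ball without the zeros of the norm. In the substitution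
    [t := r * tau], the factor [r] is the Jacobian and [r^-1 ^+ n] is split off from [t^-1 ^+ n]. *)
Definition shell_weight {R : realType} (n : nat) (r : R) : R :=
  (0 < r <= 1)%R%:R * (r * r^-1 ^+ n).

(** The point at which [f] is evaluated has norm [t^-1]. So this is an unnormalized average of [f]
    over the sphere of radius [t^-1], with directions drawn from the unit ball. *)
Definition sphere_average {R : realType} n (N : n.-tuple R -> R)
    (f : n.-tuple R -> \bar R) (t : R) : \bar R :=
  (\int[lebesgue_measureRn n]_x
     ((shell_weight n (N x))%:E * f (scale_tuple n (N x * t)^-1 x)))%E.

Section radial.
Variables (R : realType) (n : nat) (N : n.-tuple R -> R).
Hypothesis mN : measurable_fun setT N.
Hypothesis N_ge0 : forall x, 0 <= N x.
Hypothesis N_scale : forall t x, 0 < t -> N (scale_tuple n t x) = t * N x.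

Lemma radial_weight_ge0 m (t : R) : 0 <= radial_weight m t.
Proof.
rewrite /radial_weight; case: ltP => [t0|_]; last by rewrite mul0r.
by rewrite mul1r exprn_ge0// invr_ge0 ltW.
Qed.

Lemma shell_weight_ge0 m (r : R) : 0 <= shell_weight m r.
Proof.
rewrite /shell_weight; case: ltP => [r0|_]; last by rewrite mul0r.
by rewrite mulr_ge0// mulr_ge0 ?exprn_ge0// ?invr_ge0 ltW.
Qed.

Lemma measurable_radial_weight m : measurable_fun setT (@radial_weight R m).
Proof.
apply: measurable_funM.
  by apply: measurable_fun_natr_bool; exact: measurable_fun_ltr.
by apply: measurable_funX; exact: measurable_invr.
Qed.

Lemma measurable_shell_weight m : measurable_fun setT (@shell_weight R m).
Proof.
apply: measurable_funM.
  apply: measurable_fun_natr_bool; apply: measurable_and.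
    exact: measurable_fun_ltr.
  exact: measurable_fun_ler.
by apply: measurable_funM => //; apply: measurable_funX; exact: measurable_invr.
Qed.

Lemma measurable_sphere_integrand (f : n.-tuple R -> \bar R) :
  measurable_fun setT f ->
  measurable_fun setT (fun z : n.-tuple R * measurableTypeR R =>
    (shell_weight n (N z.1))%:E * f (scale_tuple n (N z.1 * z.2)^-1 z.1))%E.
Proof.
move=> mf; have mN1 : measurable_fun setT
  (fun z : n.-tuple R * measurableTypeR R => N z.1) by exact: measurableT_comp.
apply: emeasurable_funM.
  apply/measurable_EFinP; apply: (measurableT_comp (measurable_shell_weight n)).
  exact: mN1.
apply: (measurableT_comp mf); apply: measurable_fun_scale_tuple => //.
by apply: measurable_fun_inv; exact: measurable_funM.
Qed.

Lemma sphere_integrand_ge0 (f : n.-tuple R -> \bar R) : (forall x, 0 <= f x)%E ->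
  (forall z : n.-tuple R * measurableTypeR R,
    0 <= (shell_weight n (N z.1))%:E * f (scale_tuple n (N z.1 * z.2)^-1 z.1))%E.
Proof. by move=> f0 z; rewrite mule_ge0// lee_fin shell_weight_ge0. Qed.

Lemma measurable_sphere_average (f : n.-tuple R -> \bar R) :
  measurable_fun setT f -> (forall x, 0 <= f x)%E ->
  measurable_fun setT (sphere_average n N f).
Proof.
move=> mf f0.
exact: (@measurable_fun_fubini_tonelli_G _ _ _ (measurableTypeR R) _
  (lebesgue_measureRn n) _ (measurable_sphere_integrand f mf)
  (sphere_integrand_ge0 f f0)).
Qed.

(** This is the factor 1 inserted into the integral, with [c] the norm of the point: the interval
    from 0 to [c^-1] has length [c^-1]. *)
Lemma integral_inv_indic (c : R) : 0 < c ->
  (\int[lebesgue_measure]_t (((0 < t)%R%:R * c * (t * c <= 1)%R%:R)%:E : \bar R) = 1)%E.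
Proof.
move=> c0.
rewrite (eq_integral (fun t : measurableTypeR R => c%:E * (\1_`]0, c^-1] t)%:E)%E); last first.
  move=> t _; rewrite -EFinM indicE mem_setE in_itv/= -[c^-1]mul1r ler_pdivlMr//; congr EFin.
  by case: ltP; case: lerP; rewrite ?(mul0r,mulr0,mulr1,mul1r).
rewrite ge0_integralZl//; last 2 first.
- by apply/measurable_EFinP; exact: measurable_indic.
- by rewrite lee_fin ltW.
rewrite integral_indic// setIT/= lebesgue_measure_itv/= lte_fin invr_gt0 c0.
by rewrite oppr0 adde0 -EFinM mulfV// gt_eqF.
Qed.

Lemma integral_radial (f : n.-tuple R -> \bar R) (q : R -> \bar R) :
  measurable_fun setT f -> measurable_fun setT q ->
  (forall x, 0 <= f x)%E -> (forall t, 0 <= q t)%E ->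
  lebesgue_measureRn n (N @^-1` [set 0]) = 0%E ->
  (\int[lebesgue_measureRn n]_x (f x * q (N x)) =
   \int[lebesgue_measure]_t
     ((radial_weight n t)%:E * q t^-1%R * sphere_average n N f t))%E.
Proof.
move=> mf mq f0 q0 N0.
pose T : measurableType _ := (n.-tuple R * measurableTypeR R)%type.
have mN1 : measurable_fun setT (fun z : T => N z.1) by exact: measurableT_comp.
have mt : measurable_fun setT (fun z : T => z.2 : R) by exact: measurable_snd.
have mti : measurable_fun setT (fun z : T => (z.2 : R)^-1).
  exact: measurable_fun_inv.
have mpos : measurable_fun setT (fun z : T => (0 < (z.2 : R))%R%:R : R).
  by apply: measurable_fun_natr_bool; exact: measurable_fun_ltr.
(* The integrand at three stages: [A] once the factor 1 is inserted, [B] after [x := x / t], and [C]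
   after [t := N x * tau], where the radial and the directional factors have separated. *)
pose A (z : T) := (((0 < (z.2 : R))%R%:R * N z.1 * ((z.2 : R) * N z.1 <= 1)%R%:R)%:E *
  (f z.1 * q (N z.1)))%E.
pose B (z : T) := (((0 < (z.2 : R))%R%:R * (z.2 : R)^-1 ^+ n *
  ((z.2 : R)^-1 * N z.1) * (N z.1 <= 1)%R%:R)%:E *
  (f (scale_tuple n (z.2 : R)^-1 z.1) * q ((z.2 : R)^-1 * N z.1)%R))%E.
pose C (z : T) := (((radial_weight n (z.2 : R))%:E * q (z.2 : R)^-1%R) *
  ((shell_weight n (N z.1))%:E * f (scale_tuple n (N z.1 * z.2)^-1%R z.1)))%E.
have mf1 : measurable_fun setT (fun z : T => f z.1) by exact: measurableT_comp.
have mA : measurable_fun setT A.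
  apply: emeasurable_funM; last first.
    by apply: emeasurable_funM => //; exact: (measurableT_comp mq mN1).
  apply/measurable_EFinP; apply: measurable_funM; first exact: measurable_funM.
  apply: measurable_fun_natr_bool; apply: measurable_fun_ler => //.
  exact: measurable_funM.
have mB : measurable_fun setT B.
  apply: emeasurable_funM.
    apply/measurable_EFinP; apply: measurable_funM; last first.
      by apply: measurable_fun_natr_bool; exact: measurable_fun_ler.
    apply: measurable_funM; last exact: measurable_funM.
    by apply: measurable_funM => //; exact: measurable_funX.
  apply: emeasurable_funM.
    by apply: (measurableT_comp mf); exact: measurable_fun_scale_tuple.
  by apply: (measurableT_comp mq); exact: measurable_funM.
have mC : measurable_fun setT C.
  apply: emeasurable_funM; last exact: measurable_sphere_integrand.
  apply: emeasurable_funM; last exact: (measurableT_comp mq mti).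
  apply/measurable_EFinP; apply: measurableT_comp mt.
  exact: measurable_radial_weight.
have A0 z : (0 <= A z)%E.
  by rewrite mule_ge0 ?mule_ge0// lee_fin !mulr_ge0.
have B0 z : (0 <= B z)%E.
  rewrite mule_ge0 ?mule_ge0// lee_fin; case: ltP => [t0|_]; last by rewrite !mul0r.
  by rewrite !mulr_ge0// ?exprn_ge0// invr_ge0 ltW.
have C0 z : (0 <= C z)%E.
  by rewrite mule_ge0 ?mule_ge0// lee_fin ?radial_weight_ge0 ?shell_weight_ge0.
have sec (h : T -> \bar R) x : measurable_fun setT h ->
    measurable_fun setT (fun t => h (x, t)).
  by move=> mh; apply: (measurableT_comp mh); exact: measurable_fun_pair.
have sec' (h : T -> \bar R) t : measurable_fun setT h ->
    measurable_fun setT (fun x => h (x, t)).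
  by move=> mh; apply: (measurableT_comp mh); exact: measurable_fun_pair.
have mfq : measurable_fun setT (fun x => f x * q (N x))%E.
  by apply: emeasurable_funM => //; exact: measurableT_comp.
transitivity (\int[lebesgue_measureRn n]_x \int[lebesgue_measure]_t A (x, t))%E.
  apply: ge0_ae_eq_integral => //.
  - exact: measurable_fun_fubini_tonelli_F.
  - by move=> x _; rewrite mule_ge0.
  - by move=> x _; exact: integral_ge0.
  (* The inserted integral equals 1 only where [N x] is nonzero, so the two sides agree almost
     everywhere. *)
  exists (N @^-1` [set 0]); split => //.
    by rewrite -[X in measurable X]setTI; exact: mN.
  move=> x /= /not_implyP[_] /=; apply: contra_notP => Nx0.
  have {}Nx0 : 0 < N x by rewrite lt_neqAle N_ge0 andbT eq_sym; exact/eqP.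
  rewrite /A/= ge0_integralZr//.
  - by rewrite integral_inv_indic// mul1e.
  - apply/measurable_EFinP; apply: measurable_funM.
      apply: measurable_funM => //.
      by apply: measurable_fun_natr_bool; exact: measurable_fun_ltr.
    apply: measurable_fun_natr_bool; apply: measurable_fun_ler => //.
    exact: measurable_funM.
  - by move=> t _; rewrite lee_fin !mulr_ge0.
  - by rewrite mule_ge0.
rewrite (fubini_tonelli _ mA A0).
transitivity (\int[lebesgue_measure]_t \int[lebesgue_measureRn n]_x B (x, t))%E.
  apply: eq_integral => t _.
  have [t0|t0] := ltP 0 (t : R); last first.
    by rewrite !integral0_eq// => x _; rewrite /A /B/= ltNge t0/= !mul0r mul0e.
  have ti0 : 0 < (t : R)^-1 by rewrite invr_gt0.
  (* Splitting 1 this way supplies the factor with which the scaling formula for ratio [t^-1] can be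
     read from right to left. The other factor goes into [B]. *)
  have tn0 : t^-1 ^+ n * t^-1^-1 ^+ n = 1.
    by rewrite -exprMn mulfV ?expr1n// gt_eqF.
  rewrite -[LHS]mul1e -tn0 EFinM -muleA.
  rewrite -(ge0_integral_lebesgueRn_scale _ _ (t : R)^-1 (fun x => A (x, t)))//.
    2: exact: sec'.
  rewrite -ge0_integralZl//.
  - apply: eq_integral => x _; rewrite /A /B/= t0 !N_scale// muleA -EFinM.
    congr (_%:E * _)%E; rewrite !mul1r !mulrA mulfV ?gt_eqF// !mul1r.
    by [].
  - apply: (measurableT_comp (sec' _ t mA)).
    exact: measurable_fun_scale_tuple.
  - by rewrite lee_fin exprn_ge0// ltW.
rewrite -(fubini_tonelli _ mB B0).
transitivity (\int[lebesgue_measureRn n]_x \int[lebesgue_measure]_t C (x, t))%E.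
  apply: eq_integral => x _.
  have := N_ge0 x; rewrite le_eqVlt => /orP[/eqP Nx0|Nx0].
    rewrite !integral0_eq// => t _; rewrite /B /C/= -Nx0.
      by rewrite /shell_weight ltxx/= mul0r mul0e mule0.
    by rewrite !(mulr0, mul0r) mul0e.
  have cc : N x * (N x)^-1 = 1 by rewrite mulfV// gt_eqF.
  rewrite -[LHS]mul1e -cc EFinM -muleA.
  rewrite -(ge0_integral_lebesgue_scale _ (N x) (fun t => B (x, t)))//.
    2: exact: sec.
  rewrite -ge0_integralZl//.
  - apply: eq_integral => t _; rewrite /B /C/= pmulr_rgt0//.
    rewrite [((N x * t)^-1 * N x)%R](_ : _ = t^-1); last first.
      by rewrite invfM mulrAC mulVf ?mul1r// gt_eqF.
    rewrite muleACA (muleC (q _)) muleA -!EFinM; congr (_%:E * _)%E.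
    rewrite /radial_weight /shell_weight Nx0/= invfM exprMn exprS; ring.
  - apply: (measurableT_comp (sec _ x mB)).
    exact: measurable_funM.
  - by rewrite lee_fin ltW.
rewrite (fubini_tonelli _ mC C0).
apply: eq_integral => t _.
rewrite /C/= ge0_integralZl//.
- exact: (sec' _ _ (measurable_sphere_integrand f mf)).
- by move=> x _; exact: (sphere_integrand_ge0 f f0 (x, t)).
- by rewrite mule_ge0// lee_fin radial_weight_ge0.
Qed.
End radial.

(** As 0 times infinity is 0, a positive product has positive factors, and then an infinite factor
    would make the product infinite. *)
Lemma mule_fin_pos (R : realType) (a b : \bar R) : (0 <= a)%E -> (0 <= b)%E ->
  (0 < a * b < +oo)%E -> (0 < a < +oo)%E /\ (0 < b < +oo)%E.
Proof.
rewrite le_eqVlt => /orP[/eqP<-|a0]; first by rewrite mul0e ltxx.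
rewrite le_eqVlt => /orP[/eqP<-|b0]; first by rewrite mule0 ltxx.
rewrite a0 b0/= => /andP[_ ab]; split; move: ab; rewrite !ltey; apply: contra => /eqP->.
  by rewrite gt0_mulye.
by rewrite gt0_muley.
Qed.

Section sphere_average_bounds.
Variables (R : realType) (n : nat) (N : n.-tuple R -> R).
Hypothesis mN : measurable_fun setT N.
Hypothesis N_ge0 : forall x, 0 <= N x.

Lemma sphere_average_ge0 (f : n.-tuple R -> \bar R) (t : R) :
  (forall x, 0 <= f x)%E -> (0 <= sphere_average n N f t)%E.
Proof.
move=> f0; apply: integral_ge0 => x _.
exact: (sphere_integrand_ge0 _ _ _ f f0 (x, t)).
Qed.

Lemma sphere_average_section (f : n.-tuple R -> \bar R) (t : R) :
  measurable_fun setT f -> measurable_fun setT (fun x =>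
    (shell_weight n (N x))%:E * f (scale_tuple n (N x * t)^-1 x))%E.
Proof.
move=> mf; apply: (measurableT_comp (measurable_sphere_integrand _ _ _ mN f mf)
  (_ : measurable_fun setT (fun x => (x, t : measurableTypeR R)))).
exact: measurable_fun_pair.
Qed.

(** The parameter is an inverse radius, so growth along rays becomes decrease in the parameter: the
    argument of [f] at [s] is the one at [t] dilated by [t / s]. *)
Lemma sphere_average_nonincreasing (f : n.-tuple R -> R) (s t : R) :
  measurable_fun setT f -> (forall x, 0 <= f x) ->
  (forall x c, 1 < c -> f x <= f (scale_tuple n c x)) ->
  0 < s -> s <= t ->
  (sphere_average n N (EFin \o f) t <= sphere_average n N (EFin \o f) s)%E.
Proof.
move=> mf f0 fi s0; rewrite le_eqVlt => /orP[/eqP->//|st].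
have t0 : 0 < t by exact: lt_trans st.
have mf' : measurable_fun setT (EFin \o f) by exact/measurable_EFinP.
have f0' x : (0 <= (EFin \o f) x)%E by rewrite lee_fin.
apply: ge0_le_integral => //.
- by move=> x _; exact: (sphere_integrand_ge0 _ _ _ _ f0' (x, t)).
- exact: sphere_average_section.
- exact: sphere_average_section.
- move=> x _; have := N_ge0 x; rewrite le_eqVlt => /orP[/eqP Nx0|Nx0].
    by rewrite -Nx0 /shell_weight ltxx/= mul0r !mul0e.
  apply: lee_wpmul2l; first by rewrite lee_fin shell_weight_ge0.
  rewrite lee_fin.
  rewrite [X in _ <= f X](_ : _ = scale_tuple n (t / s) (scale_tuple n (N x * t)^-1 x)).
    by apply: fi; rewrite ltr_pdivlMr// mul1r.
  apply: eq_from_tnth => i; rewrite !tnth_mktuple !mulrA; congr (_ * _).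
  by field; rewrite !gt_eqF.
Qed.

(** The average of a constant function does not depend on the parameter, hence the arbitrary value 1
    in the bound. Finiteness of all averages is thereby reduced to that of a single number. *)
Lemma sphere_average_le (f : n.-tuple R -> R) (C t : R) :
  measurable_fun setT f -> (forall x, 0 <= f x <= C) ->
  (sphere_average n N (EFin \o f) t <= C%:E * sphere_average n N (cst 1%E) 1)%E.
Proof.
move=> mf fC; have f0' x : (0 <= (EFin \o f) x)%E by rewrite lee_fin; case/andP: (fC x).
have C0 : 0 <= C by case/andP: (fC [tuple 0 | i < n]); exact: le_trans.
have c0 (x : n.-tuple R) : (0 <= (cst 1 x : \bar R))%E by rewrite lee_fin.
rewrite -ge0_integralZl//; last 2 first.
- exact: (sphere_average_section (cst 1%E) 1).
- by move=> x _; exact: (sphere_integrand_ge0 _ _ _ _ c0 (x, 1)).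
apply: ge0_le_integral => //.
- by move=> x _; exact: (sphere_integrand_ge0 _ _ _ _ f0' (x, t)).
- by apply: (sphere_average_section (EFin \o f)); exact/measurable_EFinP.
- by apply: measurable_funeM; exact: (sphere_average_section (cst 1%E) 1).
- move=> x _; rewrite muleCA; apply: lee_wpmul2l.
    by rewrite lee_fin shell_weight_ge0.
  by rewrite /= mule1 lee_fin; case/andP: (fC (scale_tuple n (N x * t)^-1 x)).
Qed.
End sphere_average_bounds.

(** * The covariance inequality for two blocks of coordinates *)

Section two_blocks.
Variables (R : realType) (k l : nat).
Variables (N1 : k.-tuple R -> R) (N2 : l.-tuple R -> R).
Hypothesis mN1 : measurable_fun setT N1.
Hypothesis mN2 : measurable_fun setT N2.
Hypothesis N1_ge0 : forall x, 0 <= N1 x.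
Hypothesis N2_ge0 : forall x, 0 <= N2 x.
Hypothesis N1_scale : forall t x, 0 < t -> N1 (scale_tuple k t x) = t * N1 x.
Hypothesis N2_scale : forall t x, 0 < t -> N2 (scale_tuple l t x) = t * N2 x.
Hypothesis N1_null : lebesgue_measureRn k (N1 @^-1` [set 0]) = 0%E.
Hypothesis N2_null : lebesgue_measureRn l (N2 @^-1` [set 0]) = 0%E.
Variable W : R * R -> R.
Hypothesis mW : measurable_fun setT W.
Hypothesis W_ge0 : forall z, 0 <= W z.

(** Up to normalization, the joint density of the inverse radii of the two blocks. *)
Let w (z : measurableTypeR R * measurableTypeR R) : R :=
  radial_weight k z.1 * radial_weight l z.2 * W (z.1^-1, z.2^-1).

Lemma measurable_polar_weight : measurable_fun setT w.
Proof.
have m1 : measurable_fun setT (fun z : measurableTypeR R * measurableTypeR R => z.1 : R).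
  exact: measurable_fst.
have m2 : measurable_fun setT (fun z : measurableTypeR R * measurableTypeR R => z.2 : R).
  exact: measurable_snd.
apply: measurable_funM.
  apply: measurable_funM.
    exact: (measurableT_comp (measurable_radial_weight R k) m1).
  exact: (measurableT_comp (measurable_radial_weight R l) m2).
by apply: (measurableT_comp mW); apply: measurable_fun_pair; exact: measurable_fun_inv.
Qed.

Lemma polar_weight_ge0 z : 0 <= w z.
Proof. by rewrite /w mulr_ge0// mulr_ge0// radial_weight_ge0. Qed.

(** The radial formula is used twice: in the inner block with [x] fixed, then in the outer block,
    where the inner integral enters as the function [q] of the radius alone. *)
Lemma integral_two_blocks (u : k.-tuple R -> R) (v : l.-tuple R -> R) :
  measurable_fun setT u -> measurable_fun setT v ->
  (forall x, 0 <= u x) -> (forall x, 0 <= v x) ->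
  (\int[lebesgue_measureRn k]_x \int[lebesgue_measureRn l]_y
     (u x * v y * W (N1 x, N2 y))%:E =
   \int[lebesgue_measure]_t \int[lebesgue_measure]_s
     (sphere_average k N1 (EFin \o u) t * sphere_average l N2 (EFin \o v) s *
      (w (t, s))%:E))%E.
Proof.
move=> mu mv u0 v0.
have mu' : measurable_fun setT (EFin \o u) by exact/measurable_EFinP.
have mv' : measurable_fun setT (EFin \o v) by exact/measurable_EFinP.
have u0' x : (0 <= (EFin \o u) x)%E by rewrite lee_fin.
have v0' x : (0 <= (EFin \o v) x)%E by rewrite lee_fin.
pose U := sphere_average k N1 (EFin \o u).
pose V := sphere_average l N2 (EFin \o v).
have U0 t : (0 <= U t)%E by exact: sphere_average_ge0.
have V0 t : (0 <= V t)%E by exact: sphere_average_ge0.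
have mV : measurable_fun setT V by exact: measurable_sphere_average.
have mU : measurable_fun setT U by exact: measurable_sphere_average.
pose Q (z : R * measurableTypeR R) :=
  ((radial_weight l z.2)%:E * (W (z.1, (z.2 : R)^-1))%:E * V z.2)%E.
have Q0 z : (0 <= Q z)%E by rewrite !mule_ge0// lee_fin// radial_weight_ge0.
have mQ : measurable_fun setT Q.
  have m2 : measurable_fun setT (fun z : R * measurableTypeR R => z.2 : R).
    exact: measurable_snd.
  apply: emeasurable_funM; last exact: (measurableT_comp mV m2).
  apply: emeasurable_funM; apply/measurable_EFinP.
    exact: (measurableT_comp (measurable_radial_weight R l) m2).
  apply: (measurableT_comp mW); apply: measurable_fun_pair => //.
  exact: measurable_fun_inv.
have mWx r : measurable_fun setT (fun s => (W (r, s))%:E).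
  apply/measurable_EFinP; apply: (measurableT_comp mW).
  exact: measurable_fun_pair.
pose q r := (\int[lebesgue_measure]_s Q (r, s))%E.
transitivity (\int[lebesgue_measureRn k]_x ((EFin \o u) x * q (N1 x)))%E.
  apply: eq_integral => x _.
  have := @integral_radial R l N2 mN2 N2_ge0 N2_scale (EFin \o v)
    (fun s => (W (N1 x, s))%:E) mv' (mWx _) v0' (fun s => W_ge0 _) N2_null.
  rewrite /q /Q /= => <-.
  rewrite -ge0_integralZl//.
  - by apply: eq_integral => y _; rewrite -!EFinM mulrA.
  - apply: emeasurable_funM => //.
    exact: (measurableT_comp (mWx (N1 x)) mN2).
  - by move=> y _; rewrite -EFinM lee_fin mulr_ge0.
  - by rewrite lee_fin.
rewrite (@integral_radial R k N1 mN1 N1_ge0 N1_scale (EFin \o u) q)//.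
- apply: eq_integral => t _.
  rewrite muleAC /q -ge0_integralZl//.
  + apply: eq_integral => s _; rewrite /Q /w/= -/(U t) -/(V s) !EFinM.
    by rewrite (muleC _ (U t)) -!muleA (muleC (V s)) -!muleA.
  + apply: (measurableT_comp mQ); exact: measurable_fun_pair.
  + by rewrite mule_ge0// lee_fin radial_weight_ge0.
- exact: (measurable_fun_fubini_tonelli_F Q).
- by move=> r; exact: integral_ge0.
Qed.

(** Averaging over directions turns [f] and [g] into nonincreasing functions [F] and [G] of the
    inverse radii. The averages [c1] and [c2] of the constant 1 occur once on each side, so what
    remains is the reverse-rule inequality on the plane with weight [w]. *)
Lemma two_blocks_covariance_le (f : k.-tuple R -> R) (g : l.-tuple R -> R) (C D : R) :
  measurable_fun setT f -> measurable_fun setT g ->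
  (forall x, 0 <= f x <= C) -> (forall x, 0 <= g x <= D) ->
  (forall x c, 1 < c -> f x <= f (scale_tuple k c x)) ->
  (forall x c, 1 < c -> g x <= g (scale_tuple l c x)) ->
  (forall r r' s s', 0 < r -> r <= r' -> 0 < s -> s <= s' ->
    W (r, s) * W (r', s') <= W (r, s') * W (r', s)) ->
  (0 < \int[lebesgue_measureRn k]_x \int[lebesgue_measureRn l]_y
    (W (N1 x, N2 y))%:E < +oo)%E ->
  ((\int[lebesgue_measureRn k]_x \int[lebesgue_measureRn l]_y
     (f x * g y * W (N1 x, N2 y))%:E) *
   (\int[lebesgue_measureRn k]_x \int[lebesgue_measureRn l]_y
     (W (N1 x, N2 y))%:E) <=
   (\int[lebesgue_measureRn k]_x \int[lebesgue_measureRn l]_y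
     (f x * W (N1 x, N2 y))%:E) *
   (\int[lebesgue_measureRn k]_x \int[lebesgue_measureRn l]_y
     (g y * W (N1 x, N2 y))%:E))%E.
Proof.
move=> mf mg fC gD fi gi W_rr Zfin.
have f0 x : 0 <= f x by case/andP: (fC x).
have g0 x : 0 <= g x by case/andP: (gD x).
pose U := sphere_average k N1 (EFin \o f).
pose V := sphere_average l N2 (EFin \o g).
pose c1 := sphere_average k N1 (cst 1%E) 1.
pose c2 := sphere_average l N2 (cst 1%E) 1.
have U1 t : sphere_average k N1 (EFin \o cst 1) t = c1 by [].
have V1 t : sphere_average l N2 (EFin \o cst 1) t = c2 by [].
have c10 : (0 <= c1)%E by apply: sphere_average_ge0 => x; rewrite lee_fin.
have c20 : (0 <= c2)%E by apply: sphere_average_ge0 => x; rewrite lee_fin.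
pose I := (\int[lebesgue_measure]_t \int[lebesgue_measure]_s (w (t, s))%:E)%E.
have I0 : (0 <= I)%E.
  by apply: integral_ge0 => t _; apply: integral_ge0 => s _; rewrite lee_fin polar_weight_ge0.
have m1 : measurable_fun setT (cst 1 : k.-tuple R -> R) by [].
have m1' : measurable_fun setT (cst 1 : l.-tuple R -> R) by [].
have mwt t : measurable_fun setT (fun s => (w (t, s))%:E).
  apply/measurable_EFinP; apply: (measurableT_comp measurable_polar_weight).
  exact: measurable_fun_pair.
have w0 z : (0 <= (w z)%:E)%E by rewrite lee_fin polar_weight_ge0.
have ZE : (\int[lebesgue_measureRn k]_x \int[lebesgue_measureRn l]_y
    (W (N1 x, N2 y))%:E = c1 * c2 * I)%E.
  transitivity (\int[lebesgue_measureRn k]_x \int[lebesgue_measureRn l]_y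
    (cst 1 x * cst 1 y * W (N1 x, N2 y))%:E)%E.
    by apply: eq_integral => x _; apply: eq_integral => y _; rewrite /= !mul1r.
  rewrite integral_two_blocks//.
  under eq_integral => t _.
    under eq_integral do rewrite U1 V1.
    rewrite ge0_integralZl ?mule_ge0//.
    over.
  rewrite ge0_integralZl ?mule_ge0//.
    apply: (measurable_fun_fubini_tonelli_F (EFin \o w)) => //.
    by apply/measurable_EFinP; exact: measurable_polar_weight.
  by move=> t _; exact: integral_ge0.
(* The finiteness of the two averages [c1] and [c2] comes for free from that of the
   normalizing integral, because all three factors are positive. *)
have [/andP[c12_gt0 c12_fin] _] : (0 < c1 * c2 < +oo /\ 0 < I < +oo)%E.
  by apply: mule_fin_pos; rewrite ?mule_ge0// -ZE.
have [/andP[_ c1_fin] /andP[_ c2_fin]] : (0 < c1 < +oo /\ 0 < c2 < +oo)%E.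
  by apply: mule_fin_pos => //; rewrite c12_gt0.
have U0 t : (0 <= U t)%E by apply: sphere_average_ge0 => x; rewrite lee_fin.
have V0 t : (0 <= V t)%E by apply: sphere_average_ge0 => x; rewrite lee_fin.
have U_fin t : U t \is a fin_num.
  rewrite ge0_fin_numE// (le_lt_trans (sphere_average_le _ _ _ mN1 f C t mf fC))//.
  rewrite lte_mul_pinfty// lee_fin (le_trans (f0 [tuple 0 | i < k]))//.
  by case/andP: (fC [tuple 0 | i < k]).
have V_fin t : V t \is a fin_num.
  rewrite ge0_fin_numE// (le_lt_trans (sphere_average_le _ _ _ mN2 g D t mg gD))//.
  rewrite lte_mul_pinfty// lee_fin (le_trans (g0 [tuple 0 | i < l]))//.
  by case/andP: (gD [tuple 0 | i < l]).
pose F t := fine (U t); pose G t := fine (V t).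
have FE t : (F t)%:E = U t by rewrite fineK.
have GE t : (G t)%:E = V t by rewrite fineK.
have F0 t : 0 <= F t by rewrite fine_ge0.
have G0 t : 0 <= G t by rewrite fine_ge0.
have mF : measurable_fun setT (F : measurableTypeR R -> R).
  apply/measurable_EFinP; rewrite (_ : _ \o _ = U); last exact/funext.
  by apply: measurable_sphere_average => //; exact/measurable_EFinP.
have mG : measurable_fun setT (G : measurableTypeR R -> R).
  apply/measurable_EFinP; rewrite (_ : _ \o _ = V); last exact/funext.
  by apply: measurable_sphere_average => //; exact/measurable_EFinP.
have F_noninc s t : 0 < s -> s <= t -> F t <= F s.
  by move=> s0 st; rewrite -lee_fin !FE; exact: sphere_average_nonincreasing.
have G_noninc s t : 0 < s -> s <= t -> G t <= G s.
  by move=> s0 st; rewrite -lee_fin !GE; exact: sphere_average_nonincreasing.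
(* Monotonicity of [F] and [G] is known for positive arguments only; elsewhere the weight
   vanishes. *)
have w_le0 (t s : R) : (t <= 0) || (s <= 0) -> w (t, s) = 0.
  have rw0 m (r : R) : r <= 0 -> radial_weight m r = 0.
    by move=> r0; rewrite /radial_weight ltNge r0 mul0r.
  by rewrite /w/= => /orP[] /rw0 ->; rewrite ?(mul0r, mulr0).
have fgE : (\int[lebesgue_measureRn k]_x \int[lebesgue_measureRn l]_y
    (f x * g y * W (N1 x, N2 y))%:E =
    \int[lebesgue_measure]_t \int[lebesgue_measure]_s (F t * G s * w (t, s))%:E)%E.
  rewrite integral_two_blocks//.
  apply: eq_integral => t _; apply: eq_integral => s _.
  by rewrite !EFinM FE GE.
have pull c (H : measurableTypeR R * measurableTypeR R -> R) : (0 <= c)%E ->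
    measurable_fun setT H -> (forall z, 0 <= H z) ->
    (\int[lebesgue_measure]_t \int[lebesgue_measure]_s (c * (H (t, s))%:E) =
     c * \int[lebesgue_measure]_t \int[lebesgue_measure]_s (H (t, s))%:E)%E.
  move=> cge0 mH H0; have mH' : measurable_fun setT (EFin \o H) by exact/measurable_EFinP.
  have H0' z : (0 <= (EFin \o H) z)%E by rewrite lee_fin.
  rewrite -ge0_integralZl//.
  - apply: eq_integral => t _; rewrite ge0_integralZl//.
    + by apply: (measurableT_comp mH'); exact: measurable_fun_pair.
    + by move=> s _; rewrite lee_fin.
  - exact: (measurable_fun_fubini_tonelli_F (EFin \o H)).
  - by move=> t _; apply: integral_ge0 => s _; rewrite lee_fin.
have mFw : measurable_fun setT (fun z : measurableTypeR R * measurableTypeR R => F z.1 * w z).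
  apply: measurable_funM; last exact: measurable_polar_weight.
  exact: measurableT_comp.
have mGw : measurable_fun setT (fun z : measurableTypeR R * measurableTypeR R => G z.2 * w z).
  apply: measurable_funM; last exact: measurable_polar_weight.
  exact: measurableT_comp.
have fE : (\int[lebesgue_measureRn k]_x \int[lebesgue_measureRn l]_y
    (f x * W (N1 x, N2 y))%:E =
    c2 * \int[lebesgue_measure]_t \int[lebesgue_measure]_s (F t * w (t, s))%:E)%E.
  rewrite -(pull _ (fun z => F z.1 * w z))//; last first.
    by move=> z; rewrite mulr_ge0// polar_weight_ge0.
  transitivity (\int[lebesgue_measureRn k]_x \int[lebesgue_measureRn l]_y
    (f x * cst 1 y * W (N1 x, N2 y))%:E)%E.
    by apply: eq_integral => x _; apply: eq_integral => y _; rewrite /= mulr1.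
  rewrite integral_two_blocks//.
  apply: eq_integral => t _; apply: eq_integral => s _.
  by rewrite V1 -/(U t) -FE (muleC _ c2) -muleA -EFinM.
have gE : (\int[lebesgue_measureRn k]_x \int[lebesgue_measureRn l]_y
    (g y * W (N1 x, N2 y))%:E =
    c1 * \int[lebesgue_measure]_t \int[lebesgue_measure]_s (G s * w (t, s))%:E)%E.
  rewrite -(pull _ (fun z => G z.2 * w z))//; last first.
    by move=> z; rewrite mulr_ge0// polar_weight_ge0.
  transitivity (\int[lebesgue_measureRn k]_x \int[lebesgue_measureRn l]_y
    (cst 1 x * g y * W (N1 x, N2 y))%:E)%E.
    by apply: eq_integral => x _; apply: eq_integral => y _; rewrite /= mul1r.
  rewrite integral_two_blocks//.
  apply: eq_integral => t _; apply: eq_integral => s _.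
  by rewrite U1 -/(V s) -GE -muleA -EFinM.
rewrite fgE fE gE ZE muleCA (muleACA c2) (muleC c2 c1).
apply: lee_wpmul2l.
  exact: mule_ge0.
apply: (@integral_reverse_rule _ _ (measurableTypeR R) (measurableTypeR R) _
  lebesgue_measure lebesgue_measure F G w) => //.
  exact: measurable_polar_weight.
move=> t t' s s'.
have [t0|t0] := leP t 0.
  by rewrite !(w_le0 t) ?t0// !mul0r subrr mulr0.
have [t'0|t'0] := leP t' 0.
  by rewrite !(w_le0 t') ?t'0// !mulr0 subrr mulr0.
have [s0|s0] := leP s 0.
  by rewrite !(w_le0 _ s) ?s0 ?orbT// mulr0 mul0r subrr mulr0.
have [s'0|s'0] := leP s' 0.
  by rewrite !(w_le0 _ s') ?s'0 ?orbT// mulr0 mul0r subrr mulr0.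
(* Both products of values of [w] carry the same radial factors, so the reverse rule for [w] reduces
   to the one for [W]. *)
pose K := radial_weight k t * radial_weight k t' * (radial_weight l s * radial_weight l s').
have K0 : 0 <= K by apply: mulr_ge0; apply: mulr_ge0; exact: radial_weight_ge0.
rewrite (_ : w _ * w _ - _ = K * (W (t^-1, s^-1) * W (t'^-1, s'^-1) -
  W (t^-1, s'^-1) * W (t'^-1, s^-1))); last by rewrite /w /K/=; ring.
rewrite mulrCA; apply: mulr_ge0_le0 => //.
have inv_le (a b : R) : 0 < a -> a <= b -> b^-1 <= a^-1.
  by move=> a0 ab; rewrite lef_pV2 ?posrE// (lt_le_trans a0).
have inv0 (a : R) : 0 < a -> 0 < a^-1 by rewrite invr_gt0.
(* Since [F] and [G] are nonincreasing and inversion reverses the order, in each of the four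
   orderings the product of differences and the difference of products of [W] have opposite
   signs. *)
have [tt'|/ltW tt'] := leP t t'; have [ss'|/ltW ss'] := leP s s'.
- rewrite mulr_ge0_le0// ?mulr_ge0 ?subr_ge0 ?F_noninc ?G_noninc//.
  by rewrite subr_le0 mulrC [leRHS]mulrC; apply: W_rr => //; auto.
- rewrite mulr_le0_ge0// ?mulr_ge0_le0 ?subr_ge0 ?subr_le0 ?F_noninc ?G_noninc//.
  by rewrite mulrC [leRHS]mulrC; apply: W_rr => //; auto.
- rewrite mulr_le0_ge0// ?mulr_le0_ge0 ?subr_ge0 ?subr_le0 ?F_noninc ?G_noninc//.
  by apply: W_rr => //; auto.
- rewrite mulr_ge0_le0// ?mulr_le0 ?subr_ge0 ?subr_le0 ?F_noninc ?G_noninc//.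
  by apply: W_rr => //; auto.
Qed.
End two_blocks.

Set Implicit Arguments.
Unset Strict Implicit.

(** * Log-concave functions and the l_p norm *)

(** If [m] were not positive at the intermediate point, its extended logarithm would be -oo, below a
    finite number. *)
Lemma log_concave_ln (R : realType) (m : R -> R) (x y t : R) :
  log_concave m -> 0 <= x -> 0 <= y -> 0 <= t <= 1 -> 0 < m x -> 0 < m y ->
  0 < m (t * x + (1 - t) * y) /\
  t * ln (m x) + (1 - t) * ln (m y) <= ln (m (t * x + (1 - t) * y)).
Proof.
move=> lcm x0 y0 t01 mx0 my0; have := lcm x y t x0 y0 t01.
rewrite (lne_EFin mx0) (lne_EFin my0) -!EFinM -EFinD.
have [mz0|mz0] := ltP 0 (m (t * x + (1 - t) * y)).
  by rewrite (lne_EFin mz0) lee_fin.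
by rewrite le0_lneNy ?lee_fin.
Qed.

(** A convex combination of logarithms is at least their minimum; this quasi-concavity is what
    measurability of [m] rests on. *)
Lemma log_concave_ge_min (R : realType) (m : R -> R) (x y t : R) :
  log_concave m -> 0 <= x -> 0 <= y -> 0 <= t <= 1 -> 0 < m x -> 0 < m y ->
  Num.min (m x) (m y) <= m (t * x + (1 - t) * y).
Proof.
move=> lcm x0 y0 t01 mx0 my0.
have [mz0 mz] := log_concave_ln lcm x0 y0 t01 mx0 my0.
have min0 : 0 < Num.min (m x) (m y) by rewrite lt_min mx0.
rewrite -ler_ln ?posrE//; apply: le_trans mz.
have -> : ln (Num.min (m x) (m y)) =
  t * ln (Num.min (m x) (m y)) + (1 - t) * ln (Num.min (m x) (m y)) by ring.
case/andP: t01 => t0 t1; apply: lerD; apply: ler_wpM2l; rewrite ?subr_ge0//.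
  by rewrite ler_ln ?posrE// ge_min lexx.
by rewrite ler_ln ?posrE// ge_min lexx orbT.
Qed.

(** The set where the function exceeds [c] is an interval: the whole line if [c < 0], and otherwise
    a part of the nonnegative half-line that is convex by quasi-concavity. *)
Lemma measurable_log_concave (R : realType) (m : R -> R) :
  (forall t, 0 <= t -> 0 <= m t) -> log_concave m ->
  measurable_fun setT (fun r : R => if 0 <= r then m r else 0).
Proof.
move=> m0 lcm _; apply: (measurability _ (RGenOInfty.measurableE R)) => //.
move=> _ [_ [c ->] <-]; rewrite setTI; apply: is_interval_measurable.
have [c0|c0] := ltP c 0.
  rewrite (_ : _ @^-1` _ = setT) //.
  apply/seteqP; split=> // r _ /=; rewrite in_itv/= andbT (lt_le_trans c0)//.
  by case: ifP => // /m0.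
move=> x y /=; rewrite !in_itv/= !andbT => cx cy z /andP[xz zy].
have x0 : 0 <= x by move: cx; case: ifP => // _; rewrite ltNge c0.
have y0 : 0 <= y by move: cy; case: ifP => // _; rewrite ltNge c0.
move: cx cy; rewrite x0 y0 => cx cy; rewrite /= in_itv/= andbT (le_trans x0 xz).
have [xy|xy] := eqVneq x y.
  by have -> : z = x by apply/eqP; rewrite eq_le xz xy zy.
have {}xy : 0 < y - x by rewrite subr_gt0 lt_neqAle xy (le_trans xz).
pose t := (y - z) / (y - x).
have -> : z = t * x + (1 - t) * y by rewrite /t; field; rewrite gt_eqF.
have t01 : 0 <= t <= 1.
  by rewrite /t ler_pdivlMr// ler_pdivrMr// mul0r mul1r; apply/andP; split; lra.
apply: lt_le_trans (log_concave_ge_min lcm x0 y0 t01 _ _); rewrite ?lt_min ?cx//.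
  exact: le_lt_trans cx.
exact: le_lt_trans cy.
Qed.

(** The points [u] and [v] are convex combinations of [a] and [b] with exchanged weights, so adding
    the two concavity inequalities for the logarithm gives [ln (m a) + ln (m b)] as lower bound. *)
Lemma log_concave_mul_le (R : realType) (m : R -> R) (a b u v : R) :
  (forall t, 0 <= t -> 0 <= m t) -> log_concave m ->
  0 <= a -> a <= u -> a <= v -> u + v = a + b -> m a * m b <= m u * m v.
Proof.
move=> m0 lcm a0 au av uv.
have u0 : 0 <= u := le_trans a0 au.
have v0 : 0 <= v := le_trans a0 av.
have ub : u <= b by lra.
have b0 : 0 <= b := le_trans u0 ub.
have [ma0|ma0] := leP (m a) 0.
  have -> : m a = 0 by apply/eqP; rewrite eq_le ma0 m0.
  by rewrite mul0r mulr_ge0// m0.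
have [mb0|mb0] := leP (m b) 0.
  have -> : m b = 0 by apply/eqP; rewrite eq_le mb0 m0.
  by rewrite mulr0 mulr_ge0// m0.
have [ab|ab] := eqVneq a b.
  have -> : u = a by lra.
  by have -> : v = b by lra.
have {}ab : 0 < b - a by rewrite subr_gt0 lt_neqAle ab; lra.
pose t := (b - u) / (b - a).
have t01 : 0 <= t <= 1.
  by rewrite /t ler_pdivlMr// ler_pdivrMr// mul0r mul1r; apply/andP; split; lra.
have t01' : 0 <= 1 - t <= 1 by lra.
have uE : u = t * a + (1 - t) * b by rewrite /t; field; rewrite gt_eqF.
have vE : v = (1 - t) * a + (1 - (1 - t)) * b.
  have -> : v = a + b - u by lra.
  by rewrite /t; field; rewrite gt_eqF.
have [mu0 mu] := log_concave_ln lcm a0 b0 t01 ma0 mb0.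
have [mv0 mv] := log_concave_ln lcm a0 b0 t01' ma0 mb0.
rewrite uE vE -ler_ln ?posrE ?mulr_gt0// !lnM ?posrE//.
by apply: le_trans (lerD mu mv); rewrite le_eqVlt; apply/orP; left; apply/eqP; ring.
Qed.

Section lpnorm_facts.
Variables (R : realType) (p : R).
Hypothesis p_ge1 : 1 <= p.

Let p0 : p != 0. Proof. by rewrite gt_eqF// (lt_le_trans ltr01). Qed.

Lemma lpnorm_ge0 n (x : n.-tuple R) : 0 <= lpnorm p x.
Proof. exact: powR_ge0. Qed.

Lemma lpnorm_powR n (x : n.-tuple R) :
  lpnorm p x `^ p = \sum_(i < n) `|tnth x i| `^ p.
Proof.
rewrite /lpnorm -powRrM mulVf// powRr1// sumr_ge0// => i _; exact: powR_ge0.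
Qed.

Lemma lpnorm_scale n t (x : n.-tuple R) : 0 < t ->
  lpnorm p (scale_tuple n t x) = t * lpnorm p x.
Proof.
move=> t0; rewrite /lpnorm.
under eq_bigr do rewrite tnth_mktuple normrM powRM// (gtr0_norm t0).
rewrite -mulr_sumr powRM ?powR_ge0//; last by apply: sumr_ge0 => i _; exact: powR_ge0.
by rewrite -powRrM mulfV// powRr1// ltW.
Qed.

Lemma measurable_lpnorm n : measurable_fun setT (fun x : n.-tuple R => lpnorm p x).
Proof.
rewrite /lpnorm; apply: (measurableT_comp (measurable_powR p^-1)).
apply: measurable_sum => i.
apply: (measurableT_comp (measurable_powR p)).
by apply: measurableT_comp => //; exact: measurable_tnth.
Qed.

(** The zero set is the origin, a box of singletons. In dimension 0 it would be the whole space, of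
    mass 1. *)
Lemma lpnorm_null n : (0 < n)%N ->
  lebesgue_measureRn n ((fun x => lpnorm p x) @^-1` [set 0]) = 0%E.
Proof.
case: n => // n _; rewrite (_ : _ @^-1` _ = box n.+1 (fun=> [set 0])).
  rewrite [LHS]lebesgue_measureRn_box; last by move=> i; exact: measurable_set1.
  by rewrite big_ord_recl lebesgue_measure_set1 mul0e.
apply/seteqP; split=> x /=.
  move=> /eqP; rewrite powR_eq0 => /andP[+ _] i.
  rewrite psumr_eq0 => [/allP/(_ i (mem_index_enum _))/=|j _]; last exact: powR_ge0.
  by rewrite powR_eq0 normr_eq0 => /andP[/eqP].
move=> x0; apply/eqP; rewrite powR_eq0 invr_eq0 p0 andbT big1// => i _.
by rewrite x0 normr0 powR0.
Qed.
End lpnorm_facts.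

(** * Densities, coordinate blocks and supports *)

Import HBNNSimple.

(** For indicators this is the hypothesis on [nu]; linearity extends it to simple functions and
    monotone convergence to nonnegative measurable ones. *)
Lemma ge0_integral_density d (T : measurableType d) (R : realType)
    (mu nu : {measure set T -> \bar R}) (h : T -> R) (f : T -> \bar R) :
  measurable_fun setT h -> (forall x, 0 <= h x) ->
  (forall A, measurable A -> nu A = \int[mu]_(x in A) (h x)%:E)%E ->
  measurable_fun setT f -> (forall x, 0 <= f x)%E ->
  (\int[nu]_x f x = \int[mu]_x (f x * (h x)%:E))%E.
Proof.
move=> mh h0 nuE mf f0; pose f_ := nnsfun_approx measurableT mf.
have mh' : measurable_fun setT (EFin \o h) by exact/measurable_EFinP.
have mf_ n : measurable_fun setT (fun x => (f_ n x)%:E).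
  by apply/measurable_EFinP.
have f_nd x : {homo (fun n => (f_ n x)%:E) : a b / (a <= b)%N >-> (a <= b)%E}.
  by move=> a b ab; rewrite lee_fin; exact/lefP/nd_nnsfun_approx.
transitivity (limn (fun n => \int[nu]_x (f_ n x)%:E)%E).
  rewrite -monotone_convergence//.
  - by apply: eq_integral => x _; apply/esym/cvg_lim => //; exact: cvg_nnsfun_approx.
  - by move=> n x _; rewrite lee_fin.
transitivity (limn (fun n => \int[mu]_x ((f_ n x)%:E * (h x)%:E))%E); last first.
  rewrite -monotone_convergence//.
  - apply: eq_integral => x _; apply/cvg_lim => //.
    by apply: cvgeZr => //; exact: cvg_nnsfun_approx.
  - by move=> n; exact: emeasurable_funM.
  - by move=> n x _; rewrite -EFinM lee_fin mulr_ge0.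
  - by move=> x _ a b ab; apply: lee_wpmul2r; [rewrite lee_fin|exact: f_nd].
congr (limn _); apply/funext => n.
have fE x : (f_ n x)%:E = (\sum_(r \in range (f_ n))
    (r * \1_(f_ n @^-1` [set r]) x)%:E)%E by rewrite fimfunE fsumEFin.
under eq_integral do rewrite fE.
under [RHS]eq_integral => x _.
  rewrite fE ge0_mule_fsuml; last by move=> r; rewrite EFinM nnfun_muleindic_ge0.
  over.
rewrite !ge0_integral_fsum//; last 4 first.
- move=> r; apply: emeasurable_funM => //; apply/measurable_EFinP.
  by apply: measurable_funM.
- by move=> r x _; rewrite mule_ge0 ?(lee_fin _ (h x))// EFinM nnfun_muleindic_ge0.
- by move=> r; apply/measurable_EFinP; apply: measurable_funM.
- by move=> r x _; rewrite EFinM nnfun_muleindic_ge0.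
apply: eq_fsbigr => r; rewrite inE => -[x0 _ <-{r}].
set r := f_ n x0; set A := f_ n @^-1` [set r].
have mA : measurable A by exact: measurable_funPTI.
have r0 : (0 <= r%:E)%E by rewrite lee_fin.
transitivity (r%:E * nu A)%E.
  under eq_integral do rewrite EFinM.
  rewrite ge0_integralZl//; first by rewrite integral_indic// setIT.
  by apply/measurable_EFinP; exact: measurable_indic.
rewrite nuE// [in LHS]integral_mkcond -ge0_integralZl//.
- apply: eq_integral => x _; rewrite patchE indicE; case: (x \in A).
    by rewrite mulr1.
  by rewrite mulr0 mule0 mul0e.
- by apply/(measurable_restrictT _ _).1 => //; exact: measurable_funTS.
- by move=> x _; rewrite patchE; case: ifP; rewrite ?lee_fin.
Qed.

Section merge.
Variables (R : realType) (n k l : nat) (e : 'I_k + 'I_l -> 'I_n) (h : 'I_n -> 'I_k + 'I_l).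
Hypotheses (eK : cancel e h) (hK : cancel h e).

Definition merge_tuple (z : k.-tuple R * l.-tuple R) : n.-tuple R :=
  [tuple match h q with inl a => tnth z.1 a | inr b => tnth z.2 b end | q < n].

Lemma measurable_merge_tuple : measurable_fun setT merge_tuple.
Proof.
apply/measurable_fun_tnthP => q.
rewrite (_ : _ \o _ = fun z =>
  match h q with inl a => tnth z.1 a | inr b => tnth z.2 b end); last first.
  by apply/funext => z /=; rewrite tnth_mktuple.
case: (h q) => a.
  by apply: (measurableT_comp (measurable_tnth a)); exact: measurable_fst.
by apply: (measurableT_comp (measurable_tnth a)); exact: measurable_snd.
Qed.

(** The preimage of a box under merging is a product of two boxes, and [e] reindexes the product of
    side lengths; uniqueness on boxes does the rest. *)
Lemma lebesgue_measureRn_merge (A : set (n.-tuple R)) : measurable A ->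
  pushforward (lebesgue_measureRn k \x lebesgue_measureRn l)%E merge_tuple A =
  lebesgue_measureRn n A.
Proof.
move=> mA; pose nu :=
  measure_function_pushforward__canonical__measure_function_Measure
    (lebesgue_measureRn k \x lebesgue_measureRn l)%E measurable_merge_tuple.
apply: (@lebesgue_measureRn_unique R n nu) => // B mB; rewrite /nu /= /pushforward.
rewrite (_ : _ @^-1` _ = box k (fun a => B (e (inl a))) `*`
    box l (fun b => B (e (inr b)))); last first.
  apply/seteqP; split => -[x y] /=.
    move=> Bxy; split => a /=.
      by have := Bxy (e (inl a)); rewrite tnth_mktuple eK.
    by have := Bxy (e (inr a)); rewrite tnth_mktuple eK.
  move=> [Bx By] q; rewrite tnth_mktuple.
  have := hK q; case: (h q) => a <-; [exact: Bx|exact: By].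
rewrite product_measure1E; last 2 first.
- exact: (@measurable_box _ _ (fun a => B (e (inl a)))).
- exact: (@measurable_box _ _ (fun b => B (e (inr b)))).
rewrite (reindex e); last by exists h => x _; [exact: eK|exact: hK].
rewrite big_sumType; congr (_ * _)%E; exact: lebesgue_measureRn_box.
Qed.

Lemma ge0_integral_merge (f : n.-tuple R -> \bar R) :
  measurable_fun setT f -> (forall x, 0 <= f x)%E ->
  (\int[lebesgue_measureRn n]_x f x =
   \int[lebesgue_measureRn k]_x \int[lebesgue_measureRn l]_y f (merge_tuple (x, y)))%E.
Proof.
move=> mf f0.
have mfm : measurable_fun setT (f \o merge_tuple).
  by apply: measurableT_comp => //; exact: measurable_merge_tuple.
rewrite -(fubini_tonelli1 (f \o merge_tuple) mfm (fun z => f0 _)).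
have := @ge0_integral_pushforward _ _ _ _ _ _ measurable_merge_tuple
  (lebesgue_measureRn k \x lebesgue_measureRn l)%E _ f measurableT mf (fun y _ => f0 y).
rewrite preimage_setT => <-.
apply: eq_measure_integral; first exact: measurable_merge_tuple.
move=> mm A mA _; exact/esym/lebesgue_measureRn_merge.
Qed.
End merge.

Lemma ball_rowP (R : realType) n (x y : n.-tuple R) (e : R) : 0 < e ->
  (forall i, tnth x i - e < tnth y i < tnth x i + e) ->
  ball (row_of_tuple x) e (row_of_tuple y).
Proof.
move=> e0 xy; split => // i j; rewrite !mxE /ball/= ltr_distl.
by have /andP[h1 h2] := xy j; rewrite ltrBlDr -ltrBlDl; lra.
Qed.

Section support.
Variables (R : realType) (n : nat).

(** Rational endpoints make this a countable family; it serves as a base of the topology. *)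
Let rbox (c : n.-tuple (rat * rat)) : set (n.-tuple R) :=
  box n (fun i => `](ratr (tnth c i).1), (ratr (tnth c i).2)[%classic).

Let measurable_rbox c : measurable (rbox c).
Proof. by apply: measurable_box. Qed.

Lemma open_rational_box (U : set 'rV[R]_n) (x : n.-tuple R) :
  open U -> U (row_of_tuple x) ->
  exists2 c, rbox c x & rbox c `<=` @row_of_tuple R n @^-1` U.
Proof.
move=> oU Ux; have /nbhs_ballP[e /= e0 eU] := open_nbhs_nbhs (conj oU Ux).
have lo i : exists q : rat, ratr q \in `]tnth x i - e, tnth x i[.
  by apply: rat_in_itvoo; rewrite ltrBlDr ltrDl.
have hi i : exists q : rat, ratr q \in `]tnth x i, tnth x i + e[.
  by apply: rat_in_itvoo; rewrite ltrDl.
pose a i := xchoose (lo i); pose b i := xchoose (hi i).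
have aP i := xchooseP (lo i); have bP i := xchooseP (hi i).
exists [tuple (a i, b i) | i < n].
  move=> i; rewrite tnth_mktuple/= in_itv/=.
  by have := aP i; have := bP i; rewrite !in_itv/= => /andP[-> _] /andP[_ ->].
move=> y yc; apply: eU; apply: ball_rowP => // i.
have := yc i; rewrite tnth_mktuple/= in_itv/=.
have := aP i; have := bP i; rewrite !in_itv/= -/(a i) -/(b i).
move=> /andP[_ h1] /andP[h2 _] /andP[h3 h4].
by rewrite (lt_trans h2)// (lt_trans h4).
Qed.

Lemma measurable_preimage_row (U : set 'rV[R]_n) :
  open U -> measurable (@row_of_tuple R n @^-1` U).
Proof.
move=> oU; rewrite (_ : _ @^-1` _ = \bigcup_c
    (if `[< rbox c `<=` @row_of_tuple R n @^-1` U >] then rbox c else set0)).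
  apply: countable_bigcupT_measurable; first exact: countableP.
  by move=> c; case: ifP.
apply/seteqP; split=> [x Ux|x [c _]].
  have [c xc cU] := open_rational_box oU Ux.
  by exists c => //; case: asboolP.
by case: asboolP => // cU xc; exact: cU.
Qed.

(** A point outside the support has an open neighbourhood of measure 0, hence lies in a rational box
    of measure 0, and there are countably many such boxes. *)
Lemma negligible_setC_supp (mu : {measure set (n.-tuple R) -> \bar R}) :
  mu.-negligible (~` supp mu).
Proof.
pose F j := if unpickle j is Some c then
  if mu (rbox c) == 0%E then rbox c else set0 else set0.
have FS : ~` supp mu `<=` \bigcup_j F j.
  move=> x; rewrite /supp/= => /existsNP[U /not_implyP[oU /not_implyP[Ux mu0]]].
  have [c xc cU] := open_rational_box oU Ux.
  exists (pickle c) => //; rewrite /F pickleK ifT//.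
  rewrite eq_le measure_ge0 andbT.
  apply: (@le_trans _ _ (mu (@row_of_tuple R n @^-1` U))).
    apply: le_measure => //; rewrite inE; first exact: measurable_rbox.
    exact: measurable_preimage_row.
  by rewrite leNgt; apply/negP.
apply: (negligibleS FS); apply: negligible_bigcup => j; rewrite /F.
case: unpickle => [c|]; last exact: negligible_set0.
case: ifPn => [/eqP c0|_]; last exact: negligible_set0.
by exists (rbox c); split => //; exact: measurable_rbox.
Qed.
End support.

(** Allows functions that are bounded only on the support to be replaced by globally bounded
    nonnegative ones: the change is a constant shift outside a null set. *)
Lemma covariance_ae_shift d (T : measurableType d) (R : realType) (P : probability T R)
    (F G F' G' : T -> R) (a b : R) :
  measurable_fun setT F -> measurable_fun setT G ->
  measurable_fun setT F' -> measurable_fun setT G' ->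
  F' \in Lfun P 1 -> G' \in Lfun P 1 ->
  {ae P, forall x, F x = F' x + a} -> {ae P, forall x, G x = G' x + b} ->
  covariance P F G = covariance P F' G'.
Proof.
move=> mF mG mF' mG' iF' iG' FF' GG'.
have EE (H H' : T -> R) c : measurable_fun setT H -> measurable_fun setT H' ->
    H' \in Lfun P 1 -> {ae P, forall x, H x = H' x + c} ->
    fine ('E_P[H])%E = fine ('E_P[H'])%E + c.
  move=> mH mH' iH' HH'.
  have -> : ('E_P[H] = 'E_P[H' \+ cst c])%E.
    rewrite unlock; apply: ae_eq_integral => //.
    - exact/measurable_EFinP.
    - by apply/measurable_EFinP; exact: measurable_funD.
    - by apply: filterS HH' => x + _ => /= ->.
  rewrite expectationD ?Lfun_cst// expectation_cst fineD//.
  exact: expectation_fin_num.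
rewrite unlock (EE _ _ a mF mF' iF' FF') (EE _ _ b mG mG' iG' GG').
rewrite unlock; apply: ae_eq_integral => //.
- by apply/measurable_EFinP; apply: measurable_funM; exact: measurable_funB.
- by apply/measurable_EFinP; apply: measurable_funM; exact: measurable_funB.
- apply: filterS2 FF' GG' => x Fx Gx _ /=; rewrite !fctE/= Fx Gx.
  by congr (_ * _)%:E; ring.
Qed.

(** The second block enumerates the coordinates outside the image of [i]; the combined map is
    injective between sets of equal size, hence bijective. *)
Lemma exists_complementary_coordinates n k (i : 'I_k -> 'I_n) : injective i ->
  exists l (e : 'I_k + 'I_l -> 'I_n) h,
    [/\ cancel e h, cancel h e & forall a, e (inl a) = i a].
Proof.
move=> injI; pose A := [set q | q \notin codom i].
pose e (s : 'I_k + 'I_#|A|) : 'I_n :=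
  match s with inl a => i a | inr b => enum_val b end.
have eA b : e (inr b) \notin codom i by have := enum_valP b; rewrite inE.
have inj_e : injective e.
  move=> [a|b] [a'|b'] /=.
  - by move=> /injI ->.
  - by move=> ab; have := eA b'; rewrite /= -ab codom_f.
  - by move=> ab; have := eA b; rewrite /= ab codom_f.
  - by move=> /enum_val_inj ->.
have /(inj_card_bij inj_e)[h eK hK] : (#|'I_n| <= #|{: 'I_k + 'I_#|A|}|)%N.
  rewrite card_sum !card_ord.
  have <- : #|codom i| = k by rewrite card_codom// card_ord.
  rewrite -{1}(card_ord n) -(cardC (mem (codom i))) leq_add2l.
  by apply: subset_leq_card; apply/fintype.subsetP => q; rewrite !inE.
by exists #|A|, e, h.
Qed.

(** * The two-block inequality for log-concave densities *)

Section log_concave_density.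
Variables (R : realType) (p : R) (m : R -> R).
Hypotheses (p_ge1 : 1 <= p) (m_ge0 : forall t, 0 <= t -> 0 <= m t).
Hypothesis lcm : log_concave m.

(* The hypotheses say nothing about [m] on negative reals. *)
Let m' (r : R) : R := if 0 <= r then m r else 0.

Let m'E r : 0 <= r -> m' r = m r.
Proof. by rewrite /m' => ->. Qed.

Let m'_ge0 r : 0 <= m' r.
Proof. by rewrite /m'; case: ifP => // /m_ge0. Qed.

Let mm' : measurable_fun setT m'.
Proof. exact: measurable_log_concave. Qed.

Lemma lpnorm_density_ge0 n (x : n.-tuple R) : 0 <= m (lpnorm p x `^ p).
Proof. by rewrite m_ge0 ?powR_ge0. Qed.

Lemma measurable_lpnorm_density n :
  measurable_fun setT (fun x : n.-tuple R => m (lpnorm p x `^ p)).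
Proof.
rewrite (_ : (fun _ => _) = (fun x : n.-tuple R => m' (lpnorm p x `^ p))).
  apply: (measurableT_comp mm'); apply: (measurableT_comp (measurable_powR p)).
  exact: measurable_lpnorm.
by apply/funext => x; rewrite m'E ?powR_ge0.
Qed.

(** Merging the blocks turns the density into a function [W] of the two block norms. Its reverse
    rule is the product inequality for [m] at [r^p + s^p] and [r'^p + s'^p] against the two mixed
    sums, which have the same total. *)
Lemma integral_blocks_le n k l (e : 'I_k + 'I_l -> 'I_n) h
    (F G : n.-tuple R -> R) (f : k.-tuple R -> R) (g : l.-tuple R -> R) (C D : R) :
  (0 < k)%N -> (0 < l)%N -> cancel e h -> cancel h e ->
  measurable_fun setT F -> measurable_fun setT G ->
  measurable_fun setT f -> measurable_fun setT g ->
  (forall x, 0 <= F x) -> (forall x, 0 <= G x) ->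
  (forall x, 0 <= f x <= C) -> (forall x, 0 <= g x <= D) ->
  (forall x c, 1 < c -> f x <= f (scale_tuple k c x)) ->
  (forall x c, 1 < c -> g x <= g (scale_tuple l c x)) ->
  (forall x y, F (merge_tuple h (x, y)) = f x) ->
  (forall x y, G (merge_tuple h (x, y)) = g y) ->
  (0 < \int[lebesgue_measureRn n]_x (m (lpnorm p x `^ p))%:E < +oo)%E ->
  ((\int[lebesgue_measureRn n]_x (F x * G x * m (lpnorm p x `^ p))%:E) *
   (\int[lebesgue_measureRn n]_x (m (lpnorm p x `^ p))%:E) <=
   (\int[lebesgue_measureRn n]_x (F x * m (lpnorm p x `^ p))%:E) *
   (\int[lebesgue_measureRn n]_x (G x * m (lpnorm p x `^ p))%:E))%E.
Proof.
move=> k0 l0 eK hK mF mG mf mg F0 G0 fC gD fi gi FE GE.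
pose W (z : R * R) := m' (z.1 `^ p + z.2 `^ p).
have mW : measurable_fun setT W.
  apply: (measurableT_comp mm'); apply: measurable_funD.
    exact: (measurableT_comp (measurable_powR p) measurable_fst).
  exact: (measurableT_comp (measurable_powR p) measurable_snd).
have mE x y : m (lpnorm p (merge_tuple h (x, y)) `^ p) = W (lpnorm p x, lpnorm p y).
  rewrite /W m'E ?addr_ge0 ?powR_ge0//=; congr m.
  rewrite !lpnorm_powR// (reindex e); last by exists h => q _; [exact: eK|exact: hK].
  rewrite big_sumType/=; congr (_ + _); apply: eq_bigr => a _;
    by rewrite tnth_mktuple eK.
have md := @measurable_lpnorm_density n.
have d0 := @lpnorm_density_ge0 n.
have intE (H : n.-tuple R -> R) Q : measurable_fun setT H -> (forall x, 0 <= H x) ->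
    (forall x y, H (merge_tuple h (x, y)) = Q x y) ->
    (\int[lebesgue_measureRn n]_x (H x)%:E =
     \int[lebesgue_measureRn k]_x \int[lebesgue_measureRn l]_y (Q x y)%:E)%E.
  move=> mH H0 HQ; rewrite (ge0_integral_merge eK hK (f := EFin \o H))//; last first.
    exact/measurable_EFinP.
  by apply: eq_integral => x _; apply: eq_integral => y _; rewrite /= HQ.
rewrite (intE _ (fun x y => W (lpnorm p x, lpnorm p y)))//.
rewrite (intE _ (fun x y => f x * g y * W (lpnorm p x, lpnorm p y))); last 3 first.
- by apply: measurable_funM => //; exact: measurable_funM.
- by move=> x; rewrite !mulr_ge0.
- by move=> x y; rewrite FE GE mE.
rewrite (intE _ (fun x y => f x * W (lpnorm p x, lpnorm p y))); last 3 first.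
- exact: measurable_funM.
- by move=> x; rewrite mulr_ge0.
- by move=> x y; rewrite FE mE.
rewrite (intE _ (fun x y => g y * W (lpnorm p x, lpnorm p y))); last 3 first.
- exact: measurable_funM.
- by move=> x; rewrite mulr_ge0.
- by move=> x y; rewrite GE mE.
move=> Zfin.
apply: (@two_blocks_covariance_le R k l (fun x => lpnorm p x)
  (fun x => lpnorm p x) _ _ _ _ _ _ _ _ W mW _ f g C D) => //.
- exact: measurable_lpnorm.
- exact: measurable_lpnorm.
- by move=> x; exact: lpnorm_ge0.
- by move=> x; exact: lpnorm_ge0.
- by move=> t x t0; exact: lpnorm_scale.
- by move=> t x t0; exact: lpnorm_scale.
- exact: lpnorm_null.
- exact: lpnorm_null.
- by move=> z; exact: m'_ge0.
have p_ge0 : 0 <= p := le_trans ler01 p_ge1.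
move=> r r' s s' r0 rr' s0 ss'; rewrite /W/= !m'E ?addr_ge0 ?powR_ge0//.
have rp : r `^ p <= r' `^ p by rewrite ge0_ler_powR// nnegrE ltW// (lt_le_trans r0).
have sp : s `^ p <= s' `^ p by rewrite ge0_ler_powR// nnegrE ltW// (lt_le_trans s0).
apply: log_concave_mul_le; rewrite ?addr_ge0 ?powR_ge0 ?lerD//.
ring.
Qed.
End log_concave_density.

(** * Truncated functions of the absolute coordinates, and the theorem *)

Lemma Lfun1_bounded d (T : measurableType d) (R : realType) (P : probability T R)
    (F : T -> R) (C : R) :
  measurable_fun setT F -> (forall x, 0 <= F x <= C) -> F \in Lfun P 1.
Proof.
move=> mF FC; apply/Lfun1_integrable; apply: measurable_bounded_integrable => //.
  by rewrite -ge0_fin_numE// fin_num_measure.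
exists C; split => [|M CM x _ /=]; first exact: num_real.
by case/andP: (FC x) => F0 FleC; rewrite ger0_norm// (le_trans FleC)// ltW.
Qed.

Lemma measurable_orthant (R : realType) k : measurable (@orthant R k).
Proof.
rewrite (_ : @orthant R k = box k (fun=> `[0, +oo[%classic)).
  exact: (@measurable_box _ _ (fun=> `[0, +oo[%classic)).
by apply/seteqP; split => x xq q; have := xq q; rewrite /= in_itv/= andbT.
Qed.

Lemma orthant_abs_coords (R : realType) n k (i : 'I_k -> 'I_n) (x : n.-tuple R) :
  orthant (abs_coords i x).
Proof. by move=> a; rewrite tnth_mktuple. Qed.

Lemma measurable_abs_coords_comp (R : realType) n k (i : 'I_k -> 'I_n)
    (f : k.-tuple R -> R) : measurable_fun (@orthant R k) f ->
  measurable_fun setT (fun x => f (abs_coords i x)).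
Proof.
move=> mf; apply: (measurable_comp (F := @orthant R k)) => //.
- exact: measurable_orthant.
- by move=> _ [x _ <-]; exact: orthant_abs_coords.
apply/measurable_fun_tnthP => a.
rewrite (_ : _ \o _ = fun x : n.-tuple R => `|tnth x (i a)|); last first.
  by apply/funext => x /=; rewrite tnth_mktuple.
by apply: measurableT_comp => //; exact: measurable_tnth.
Qed.

(** Truncation to [[-M, M]], then a shift by [M] that makes the result nonnegative as the Tonelli
    arguments require. *)
Definition clip {R : realType} (M r : R) : R := Num.min (Num.max r (- M)) M + M.

Lemma clip_bounds (R : realType) (M r : R) : 0 <= M -> 0 <= clip M r <= M + M.
Proof.
move=> M0; rewrite /clip lerD2r ge_min lexx orbT andbT -lerBlDr sub0r.
by rewrite le_min le_max lexx orbT /=; lra.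
Qed.

Lemma clip_id (R : realType) (M r : R) : `|r| <= M -> clip M r = r + M.
Proof.
by rewrite ler_norml /clip => /andP[h1 h2]; rewrite max_l// min_l.
Qed.

Lemma le_clip (R : realType) (M r s : R) : r <= s -> clip M r <= clip M s.
Proof. by move=> rs; rewrite /clip lerD2r; apply: le_min2 => //; apply: le_max2. Qed.

Lemma measurable_clip (R : realType) (M : R) : measurable_fun setT (clip M).
Proof.
by apply: measurable_funD => //; apply: measurable_minr => //; exact: measurable_maxr.
Qed.

Unset Implicit Arguments.

Theorem theorem1p3 (R : realType) (p : R) (n : nat) (m : R -> R)
    (mu : probability (n.-tuple R) R)
    (k l : nat) (i : 'I_k -> 'I_n) (j : 'I_l -> 'I_n)
    (f : k.-tuple R -> R) (g : l.-tuple R -> R)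
    (d : measure_display) (Omega : measurableType d)
    (P : probability Omega R) (X : {RV P >-> n.-tuple R}) :
  1 <= p ->
  (forall t, 0 <= t -> 0 <= m t) ->
  log_concave m ->
  (0 < \int[lebesgue_measureRn n]_x (m (lpnorm p x `^ p))%:E < +oo)%E ->
  density_proportional mu (fun x => m (lpnorm p x `^ p)) ->
  injective i -> injective j -> (forall a b, i a <> j b) ->
  measurable_fun (@orthant R k) f -> measurable_fun (@orthant R l) g ->
  radiuswise_increasing f -> radiuswise_increasing g ->
  [bounded f (abs_coords i x) | x in supp mu] ->
  [bounded g (abs_coords j x) | x in supp mu] ->
  (forall A, measurable A -> distribution P X A = mu A) ->
  (covariance P (fun w => f (abs_coords i (X w)))
                (fun w => g (abs_coords j (X w))) <= 0)%E.
Proof.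
move=> p_ge1 m_ge0 lcm Zfin [c muE] injI injJ ij mf mg fi gi fb gb muX.
(* The polar formula needs blocks of positive dimension. A function of an empty block is constant,
   and its covariances vanish. *)
case: k => [|k] in i f injI ij mf fi fb *.
  rewrite (_ : (fun w => f _) = cst (f [tuple])) ?covariance_cst_l//.
  by apply/funext => w; congr f; exact: tuple0.
case: l => [|l] in j g injJ ij mg gi gb *.
  rewrite (_ : (fun w => g _) = cst (g [tuple])) ?covariance_cst_r//.
  by apply/funext => w; congr g; exact: tuple0.
have bounded_supp (phi : n.-tuple R -> R) : [bounded phi x | x in supp mu] ->
    exists2 M : R, 0 <= M & forall x, supp mu x -> `|phi x| <= M.
  by move=> /pinfty_ex_gt0[M M0 phiM]; exists M; [exact: ltW|exact: phiM].
have [Mf Mf0 fM] := bounded_supp _ fb.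
have [Mg Mg0 gM] := bounded_supp _ gb.
have [l' [e [h [eK hK eI]]]] := exists_complementary_coordinates injI.
have hI a : h (i a) = inl a by rewrite -eI eK.
have hJ b : exists b', h (j b) = inr b'.
  case hjb : (h (j b)) => [a|b']; last by exists b'.
  by have := ij a b; rewrite -eI -hjb hK.
have l'_gt0 : (0 < l')%N by have [[q ql] _] := hJ ord0; exact: leq_ltn_trans ql.
pose F (x : n.-tuple R) := clip Mf (f (abs_coords i x)).
pose G (x : n.-tuple R) := clip Mg (g (abs_coords j x)).
pose f' (x : k.+1.-tuple R) := clip Mf (f (abs_coords id x)).
(* The zeros fill the first block, on which [G] does not depend because the image of [j] lies in the
   complementary block. *)
pose g' (y : l'.-tuple R) := G (merge_tuple h ([tuple 0 | _ < k.+1], y)).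
have mfi := measurable_abs_coords_comp i mf.
have mgj := measurable_abs_coords_comp j mg.
have mF : measurable_fun setT F by exact: (measurableT_comp (measurable_clip Mf) mfi).
have mG : measurable_fun setT G by exact: (measurableT_comp (measurable_clip Mg) mgj).
have mf' : measurable_fun setT f'.
  apply: (measurableT_comp (measurable_clip Mf)).
  exact: measurable_abs_coords_comp.
have mg' : measurable_fun setT g'.
  apply: (measurableT_comp mG).
  apply: (measurableT_comp (measurable_merge_tuple h)).
  exact: measurable_fun_pair.
have F_bounds x : 0 <= F x <= Mf + Mf by exact: clip_bounds.
have G_bounds x : 0 <= G x <= Mg + Mg by exact: clip_bounds.
have F0 x : 0 <= F x by case/andP: (F_bounds x).
have G0 x : 0 <= G x by case/andP: (G_bounds x).
have FE x y : F (merge_tuple h (x, y)) = f' x.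
  congr (clip _ (f _)); apply: eq_from_tnth => a.
  by rewrite !tnth_mktuple hI.
have GE x y : G (merge_tuple h (x, y)) = g' y.
  congr (clip _ (g _)); apply: eq_from_tnth => b.
  by rewrite !tnth_mktuple; have [b' ->] := hJ b.
have abs_scale t r : 1 < t -> `|t * r| = t * `|r| :> R.
  by move=> t1; rewrite normrM gtr0_norm// (lt_trans ltr01).
have f'_incr x t : 1 < t -> f' x <= f' (scale_tuple k.+1 t x).
  move=> t1; apply: le_clip.
  apply: le_trans (fi _ t (orthant_abs_coords _ _) t1) _.
  rewrite le_eqVlt; apply/orP; left; apply/eqP; congr f.
  by apply: eq_from_tnth => a; rewrite !tnth_mktuple abs_scale.
have g'_incr y t : 1 < t -> g' y <= g' (scale_tuple l' t y).
  move=> t1; apply: le_clip.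
  apply: le_trans (gi _ t (orthant_abs_coords _ _) t1) _.
  rewrite le_eqVlt; apply/orP; left; apply/eqP; congr g.
  apply: eq_from_tnth => b; rewrite !tnth_mktuple.
  by have [b' ->] := hJ b; rewrite tnth_mktuple abs_scale.
have main := integral_blocks_le p_ge1 m_ge0 lcm (ltn0Sn k) l'_gt0 eK hK
  mF mG mf' mg' F0 G0 (fun x => clip_bounds _ Mf0) (fun x => clip_bounds _ Mg0)
  f'_incr g'_incr FE GE Zfin.
have mX : measurable_fun setT X by exact: measurable_funP.
pose dens (x : n.-tuple R) := m (lpnorm p x `^ p).
have md : measurable_fun setT dens by exact: measurable_lpnorm_density.
have d0 x : 0 <= dens x by exact: lpnorm_density_ge0.
have Zc : (\int[lebesgue_measureRn n]_x (c * dens x)%:E = 1)%E.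
  by rewrite -muE// probability_setT.
have cZ : (c%:E * \int[lebesgue_measureRn n]_x (dens x)%:E = 1)%E.
  rewrite -Zc -integralZl//; apply/integrableP; split; first exact/measurable_EFinP.
  case/andP: Zfin => _ Zlt; rewrite (eq_integral (fun x => (dens x)%:E))//.
  by move=> x _; rewrite /= ger0_norm.
(* The sign of the proportionality constant is not assumed; it follows from total mass 1 and a
   nonnegative normalizing integral. *)
have c_gt0 : 0 < c.
  rewrite ltNge; apply/negP => c0; suff : (1 <= 0 :> \bar R)%E by rewrite lee_fin ler10.
  by rewrite -cZ mule_le0_ge0// ?lee_fin//; case/andP: Zfin => /ltW.
have intE (H : n.-tuple R -> R) : measurable_fun setT H -> (forall x, 0 <= H x) ->
    (\int[P]_w (H (X w))%:E =
     c%:E * \int[lebesgue_measureRn n]_x (H x * dens x)%:E)%E.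
  move=> mH H0; have mH' : measurable_fun setT (EFin \o H) by exact/measurable_EFinP.
  have H0' x : (0 <= (EFin \o H) x)%E by rewrite lee_fin.
  rewrite -[LHS](ge0_integral_distribution (P := P) X mH' H0').
  rewrite (eq_measure_integral mu); last by move=> A mA _; exact: muX.
  rewrite (@ge0_integral_density _ _ R (lebesgue_measureRn n) mu (fun x => c * dens x))//.
  - rewrite -ge0_integralZl//.
    + by apply: eq_integral => x _; rewrite /= -!EFinM mulrCA.
    + by apply/measurable_EFinP; exact: measurable_funM.
    + by move=> x _; rewrite lee_fin mulr_ge0.
    + by rewrite lee_fin ltW.
  - exact: measurable_funM.
  - by move=> x; rewrite mulr_ge0// ltW.
have ae_supp : {ae P, forall w, supp mu (X w)}.
  have [N [mN N0 suppN]] := negligible_setC_supp mu.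
  exists (X @^-1` N); split.
  - by rewrite -[X in measurable X]setTI; exact: mX.
  - exact: etrans (muX _ mN) N0.
  - by move=> w /= nsupp; exact: suppN.
have mFX : measurable_fun setT (F \o X) by exact: measurableT_comp.
have mGX : measurable_fun setT (G \o X) by exact: measurableT_comp.
have LF : F \o X \in Lfun P 1 by apply: (Lfun1_bounded P mFX) => w; exact: F_bounds.
have LG : G \o X \in Lfun P 1 by apply: (Lfun1_bounded P mGX) => w; exact: G_bounds.
have LFG : (F \o X) * (G \o X) \in Lfun P 1.
  apply: (@Lfun1_bounded _ _ _ P _ ((Mf + Mf) * (Mg + Mg))).
    exact: measurable_funM.
  move=> w /=; rewrite mulr_ge0//=.
  by apply: ler_pM => //=; [case/andP: (F_bounds (X w))|case/andP: (G_bounds (X w))].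
(* Almost surely [X] lies in the support of [mu], where truncation changes nothing, so the clipped
   functions differ from the original ones by the constants [Mf] and [Mg]. *)
rewrite (@covariance_ae_shift _ _ _ P _ _ (F \o X) (G \o X) (- Mf) (- Mg))//; last 4 first.
- exact: (measurableT_comp mfi mX).
- exact: (measurableT_comp mgj mX).
- by apply: filterS ae_supp => w sw; rewrite /F/= clip_id ?addrK//; exact: fM.
- by apply: filterS ae_supp => w sw; rewrite /G/= clip_id ?addrK//; exact: gM.
rewrite covarianceE//.
rewrite sube_le0 unlock.
rewrite [leLHS](intE (fun x => F x * G x)); last 2 first.
- exact: measurable_funM.
- by move=> x; rewrite mulr_ge0.
rewrite [X in (_ <= X * _)%E](intE F)// [X in (_ <= _ * X)%E](intE G)//.
(* Inserting [c] times the normalizing integral, which is 1, gives both sides the common factor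
   [c * c] and produces the form of [main]. *)
rewrite -[leLHS]mule1 -[X in (_ * X <= _)%E]cZ muleACA [leRHS]muleACA.
by apply: lee_wpmul2l => //; rewrite -EFinM lee_fin mulr_ge0 ?ltW.
Qed.
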